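(* Let $X$ be a Banach space and let $(\Omega,\Sigma,\mu)$ be a positive $\sigma$-finite measure space. Then for each $\varphi\in L^1(\Omega,\Sigma,\mu,X)^*$ there exists a function $g:\Omega\to X^*$ such that (1) $g$ is $w^*$-measurable; (2) the function $\omega\mapsto\|g(\omega)\|$ belongs to $L^\infty(\mu)$; (3) $\displaystyle \varphi(f)=\int_\Omega \langle g(\omega),f(\omega)\rangle_{X^*,X}\,d\mu(\omega)$ for all $f\in L^1(\Omega,\Sigma,\mu,X)$; (4) $\|\varphi\|=\big\|\,\|g(\cdot)\|\,\big\|_\infty$.
   Context: $L^1(\Omega,\Sigma,\mu,X)$ is the Banach space of (classes of) Bochner integrable functions $f:\Omega\to X$ with norm $\int_\Omega\|f\|\,d\mu$. Scalars are complex. A function $g:\Omega\to X^*$ is called $w^*$-measurable if for every $x\in X$ the scalar function $\omega\mapsto\langle g(\omega),x\rangle$ is $\mu$-measurable (that is, measurable with respect to the $\mu$-completion of $\Sigma$). $\langle\cdot,\cdot\rangle_{X^*,X}$ is the duality pairing. *)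

(* Defs.v *)
From HB Require Import structures.
From mathcomp Require Import all_boot all_order all_algebra.
From mathcomp Require Import all_classical all_reals all_analysis.
From mathcomp Require Import measurable_realfun.
From mathcomp.real_closed Require Import complex.
From mathcomp Require Import generic_quotient ring_quotient.

Set Implicit Arguments.
Unset Strict Implicit.
Unset Printing Implicit Defensive.
Import Order.TTheory GRing.Theory Num.Theory.
Import numFieldNormedType.Exports.

Local Open Scope classical_set_scope.
Local Open Scope complex_scope.
Local Open Scope quotient_scope.
Local Open Scope ring_scope.

Section real_norm.
Context {R : realType} {V : normedModType R[i]}.

(* The norm of a complex normed space is valued in the nonnegative elements of
   R[i]; rnorm is the same number seen in R (see rnormE). *)
Definition rnorm (x : V) : R := complex.Re `|x|.

Lemma rnormE (x : V) : `|x| = (rnorm x)%:C.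
Proof.
rewrite /rnorm; have := normr_ge0 x.
by case: `|x| => a b; rewrite lecE /= => /andP[/eqP -> _].
Qed.

Lemma rnorm_ge0 (x : V) : 0 <= rnorm x.
Proof. by rewrite -lecR -rnormE; exact: normr_ge0. Qed.

Lemma rnormD (x y : V) : rnorm (x + y) <= rnorm x + rnorm y.
Proof. by rewrite -lecR rmorphD /= -!rnormE ler_normD. Qed.

Lemma rnorm0 : rnorm 0 = 0.
Proof. by rewrite /rnorm normr0. Qed.

Lemma rnorm_eq0 (x : V) : rnorm x = 0 -> x = 0.
Proof. by move=> x0; apply/normr0_eq0; rewrite rnormE x0. Qed.

Lemma rnormN (x : V) : rnorm (- x) = rnorm x.
Proof. by rewrite /rnorm normrN. Qed.

Lemma rnormZ (a : R[i]) (x : V) : rnorm (a *: x) = complex.Re `|a| * rnorm x.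
Proof.
apply: complexI; rewrite -rnormE normrZ rnormE rmorphM; congr (_ * _).
Qed.

Lemma ler_dist_rnorm (x y : V) : `|rnorm x - rnorm y| <= rnorm (x - y).
Proof.
rewrite ler_norml lerBrDl lerBlDr; apply/andP; split.
  by rewrite -[X in _ + X]rnormN opprB (le_trans _ (rnormD _ _))// addrC subrK.
by rewrite lerBlDr (le_trans _ (rnormD _ _))// subrK.
Qed.

Lemma cvg_rnorm (u : nat -> V) (l : V) :
  u n @[n --> \oo] --> l -> rnorm (u n) @[n --> \oo] --> rnorm l.
Proof.
move=> /cvgrPdist_lt ul; apply/cvgrPdist_lt => e e0.
have e0' : 0 < e%:C :> R[i] by rewrite ltcR.
apply: filterS (ul _ e0') => n; rewrite rnormE ltcR.
exact/le_lt_trans/ler_dist_rnorm.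
Qed.

End real_norm.

Section dual.
Context {R : realType}.

Record dual (V : normedModType R[i]) := Dual {
  dual_linear :> {linear V -> R[i]^o} ;
  dual_continuous : continuous dual_linear }.

(* The operator norm. The set contains 0 and, f being continuous and linear, is
   bounded, so the default value of sup on other sets plays no role. *)
Definition dual_norm (V : normedModType R[i]) (f : dual V) : R :=
  sup [set rnorm (f x) | x in [set x : V | rnorm x <= 1]].

End dual.

Section measurability.
Context {R : realType} {d : measure_display} {T : measurableType d}.
Variable mu : {measure set T -> \bar R}.

(* completed_algebra_gen mu consists of the sets A `|` N with A measurable and N
   mu-negligible, i.e. it is the mu-completion of the sigma-algebra of T. *)
Definition mu_measurable {Y : topologicalType} (h : T -> Y) :=
  forall U : set Y, open U -> completed_algebra_gen mu (h @^-1` U).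

Definition mem_Linfty (h : T -> R) :=
  mu_measurable h /\ ('N[mu]_+oo[EFin \o h] < +oo)%E.

Definition weak_star_measurable {X : normedModType R[i]} (g : T -> dual X) :=
  forall x : X, mu_measurable (fun w => g w x).

(* The library integral is defined for arbitrary functions as a supremum over
   measurable simple functions. It does not distinguish functions that agree
   mu-a.e. (see ae_integral_eq below), so on completion-measurable functions it
   is the integral with respect to the completion of mu. *)
Definition cintegrable (h : T -> R[i]^o) :=
  mu_measurable h /\ (\int[mu]_w (rnorm (h w))%:E < +oo)%E.

Definition cintegral (h : T -> R[i]^o) : R[i] :=
  Rintegral mu setT (fun w => complex.Re (h w)) +i*
  Rintegral mu setT (fun w => complex.Im (h w)).

End measurability.

Section ae_integral.
Context {R : realType} {d : measure_display} {T : measurableType d}.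
Variable mu : {measure set T -> \bar R}.
Local Open Scope ereal_scope.
Import HBNNSimple.

Lemma ae_ge0_integral_le (f g : T -> \bar R) :
  (forall w, 0 <= f w) -> (forall w, 0 <= g w) ->
  {ae mu, forall w, f w <= g w} -> \int[mu]_w f w <= \int[mu]_w g w.
Proof.
move=> f0 g0 [N [mN N0 fgN]].
rewrite !ge0_integralTE//; apply: ge_ereal_sup => _ [h /= hf <-].
have mNC : measurable (~` N) by exact: measurableC.
pose k : {nnsfun T >-> R} := proj_nnsfun h mNC.
apply: ereal_sup_ubound; exists k => /=.
  move=> w; rewrite /k /= mindicE.
  case: (boolP (w \in ~` N)) => wN; rewrite ?mulr1 ?mulr0//.
  rewrite (le_trans (hf w))//; apply: contrapT => nfg.
  by move: wN; rewrite inE; apply; exact: fgN.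
rewrite -[RHS]integralT_nnsfun -(integralT_nnsfun mu k); apply: ae_eq_integral => //.
- exact/measurable_EFinP.
- exact/measurable_EFinP.
exists N; split => // w /=; apply: contra_notP => Nw _; congr (_%:E).
by rewrite /= mindicE mem_set ?mulr1.
Qed.

Lemma ae_ge0_integral_eq (f g : T -> \bar R) :
  (forall w, 0 <= f w) -> (forall w, 0 <= g w) ->
  {ae mu, forall w, f w = g w} -> \int[mu]_w f w = \int[mu]_w g w.
Proof.
move=> f0 g0 fg; apply/eqP; rewrite eq_le.
by apply/andP; split; apply: ae_ge0_integral_le => //;
  apply: filterS fg => w ->.
Qed.

Lemma ae_integral_eq (f g : T -> \bar R) :
  {ae mu, forall w, f w = g w} -> \int[mu]_w f w = \int[mu]_w g w.
Proof.
move=> fg; rewrite integralE [RHS]integralE.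
by congr (_ - _); apply: ae_ge0_integral_eq => //; apply: filterS fg => w;
  rewrite ?funeposE ?funenegE => ->.
Qed.

End ae_integral.

Section simple_functions.
Context {R : realType} {d : measure_display} {T : measurableType d}.
Variable mu : {measure set T -> \bar R}.

(* Unlike the library's simple functions, no sigma-algebra on the codomain is
   required: measurability is that of the fibers. *)
Definition simple {Y : Type} (s : T -> Y) :=
  finite_set (range s) /\ forall y, measurable (s @^-1` [set y]).

Lemma simple_preimage (Y : choiceType) (s : T -> Y) (A : set Y) :
  simple s -> measurable (s @^-1` A).
Proof.
move=> [fs ms].
have -> : s @^-1` A = \bigcup_(y in range s `&` A) (s @^-1` [set y]).
  apply/seteqP; split => [w Aw|w [y [_ Ay] /= ->//]].
  by exists (s w).
apply: fin_bigcup_measurable => //; exact: finite_setIl.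
Qed.

Lemma simple_op (Y1 Y2 Y : choiceType) (op : Y1 -> Y2 -> Y)
    (s : T -> Y1) (t : T -> Y2) :
  simple s -> simple t -> simple (fun w => op (s w) (t w)).
Proof.
move=> [fs ms] [ft mt].
have st : simple (fun w => (s w, t w)).
  split.
    apply: sub_finite_set (finite_setX fs ft).
    by move=> _ [w _ <-]; split; exists w.
  move=> [y z].
  have -> : (fun w => (s w, t w)) @^-1` [set (y, z)] =
      s @^-1` [set y] `&` t @^-1` [set z].
    by apply/seteqP; split => w /= [-> ->].
  exact: measurableI.
split.
  have -> : (fun w => op (s w) (t w)) =
      (fun p => op p.1 p.2) \o (fun w => (s w, t w)) by [].
  by rewrite -image_comp; apply: finite_image; case: st.
move=> y.
have -> : (fun w => op (s w) (t w)) @^-1` [set y] =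
   (fun w => (s w, t w)) @^-1` [set p | op p.1 p.2 = y] by [].
exact: simple_preimage.
Qed.

End simple_functions.

Section bochner.
Context {R : realType} {d : measure_display} {T : measurableType d}.
Variable mu : {measure set T -> \bar R}.
Variable X : normedModType R[i].
Implicit Types f g : T -> X.

Definition integrable_simple (s : T -> X) :=
  simple s /\ (mu [set w | s w <> 0%R] < +oo)%E.

(* mu-measurability in the sense of Bochner: almost everywhere limit of simple
   functions. *)
Definition strongly_measurable (f : T -> X) :=
  exists s : nat -> T -> X, (forall n, simple (s n)) /\
    {ae mu, forall w, s n w @[n --> \oo] --> f w}.

Definition bochner_integrable (f : T -> X) :=
  strongly_measurable f /\
  exists s : nat -> T -> X, (forall n, integrable_simple (s n)) /\
    (\int[mu]_w (rnorm (f w - s n w))%:E)%E @[n --> \oo] --> 0%E.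

Definition int_norm (f : T -> X) : \bar R := (\int[mu]_w (rnorm (f w))%:E)%E.

Lemma re_norm_ge0 (a : R[i]) : (0 <= (complex.Re `|a|)%:E)%E.
Proof. by rewrite lee_fin; exact: (rnorm_ge0 (a : R[i]^o)). Qed.

Lemma int_norm_ge0 f : (0 <= int_norm f)%E.
Proof. by apply: integral_ge0 => w _; rewrite lee_fin rnorm_ge0. Qed.

Lemma strongly_measurable_simple f : simple f -> strongly_measurable f.
Proof.
by move=> sf; exists (fun=> f); split => //; apply/nearW => w; exact: cvg_cst.
Qed.

Lemma strongly_measurable_lin (a : R[i]) f g :
  strongly_measurable f -> strongly_measurable g ->
  strongly_measurable (a *: f + g).
Proof.
move=> [s [ss sf]] [t [ts tg]]; exists (fun n => a *: s n + t n); split.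
  by move=> n; exact: (simple_op (fun x y => a *: x + y)).
apply: filterS2 sf tg => w sf tg.
by apply: cvgD => //; apply: cvgZr.
Qed.

Lemma rnorm_representative f : strongly_measurable f ->
  exists h : T -> \bar R, [/\ measurable_fun setT h,
    (forall w, 0 <= h w)%E & {ae mu, forall w, (rnorm (f w))%:E = h w}].
Proof.
move=> [s [ss [N [mN N0 sf]]]].
exists (fun w => ((rnorm (f w)) * \1_(~` N) w)%:E); split; last 2 first.
- by move=> w; rewrite lee_fin mulr_ge0 ?rnorm_ge0.
- exists N; split => // w /=; apply: contra_notP => Nw.
  by rewrite indicE mem_set ?mulr1.
apply: (emeasurable_fun_cvg (fun n w => (rnorm (s n w) * \1_(~` N) w)%:E)).
  move=> n; apply/measurable_EFinP; apply: measurable_funM; last first.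
    by apply: measurable_indic; exact: measurableC.
  by move=> _ B mB; rewrite setTI; exact: (simple_preimage (rnorm @^-1` B) (ss n)).
move=> w _; apply: cvg_EFin; first by apply: nearW.
rewrite indicE; case: (boolP (w \in ~` N)) => wN; last first.
  by rewrite mulr0; under eq_fun do rewrite /= mulr0; exact: cvg_cst.
rewrite mulr1; under eq_fun do rewrite /= mulr1.
apply: cvg_rnorm; apply: contrapT => nsf.
by move: wN; rewrite inE; apply; exact: sf.
Qed.

Lemma int_norm_lin (a : R[i]) f g :
  strongly_measurable f -> strongly_measurable g ->
  (int_norm (a *: f + g)%R <= (complex.Re `|a|)%:E * int_norm f + int_norm g)%E.
Proof.
move=> /rnorm_representative[h [mh h0 fh]] /rnorm_representative[k [mk k0 gk]].
have a0 := re_norm_ge0 a.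
rewrite /int_norm (ae_ge0_integral_eq _ h0 fh) ?(ae_ge0_integral_eq _ k0 gk);
  try by move=> w; rewrite lee_fin rnorm_ge0.
rewrite -ge0_integralZl// -ge0_integralD//; last 2 first.
- by move=> w _; exact: mule_ge0.
- exact: measurable_funeM.
apply: ae_ge0_integral_le => [w|w|].
- by rewrite lee_fin rnorm_ge0.
- by rewrite adde_ge0// mule_ge0.
apply: filterS2 fh gk => w <- <-.
by rewrite -EFinM -EFinD lee_fin -rnormZ rnormD.
Qed.

Lemma int_norm_ae f g :
  {ae mu, forall w, f w = g w} -> int_norm f = int_norm g.
Proof. by move=> fg; apply: ae_integral_eq; apply: filterS fg => w ->. Qed.

Lemma int_normZ (a : R[i]) f : strongly_measurable f ->
  int_norm (a *: f)%R = ((complex.Re `|a|)%:E * int_norm f)%E.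
Proof.
move=> /rnorm_representative[h [mh h0 fh]].
have a0 := re_norm_ge0 a.
rewrite /int_norm (ae_ge0_integral_eq _ h0 fh); last first.
  by move=> w; rewrite lee_fin rnorm_ge0.
rewrite -ge0_integralZl//; apply: ae_integral_eq.
by apply: filterS fh => w <-; rewrite -EFinM -rnormZ.
Qed.

Lemma int_norm_eq0 f : strongly_measurable f -> int_norm f = 0%E ->
  {ae mu, forall w, f w = 0}.
Proof.
move=> /rnorm_representative[h [mh h0 fh]].
rewrite /int_norm (ae_ge0_integral_eq _ h0 fh); last first.
  by move=> w; rewrite lee_fin rnorm_ge0.
under eq_integral do rewrite -[h _]gee0_abs//.
move=> /(ae_eq_integral_abs mu measurableT mh) hE.
apply: filterS2 fh hE => w fh /(_ I); rewrite -fh => -[].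
exact: rnorm_eq0.
Qed.

Lemma integrable_simple_lin (a : R[i]) (s t : T -> X) :
  integrable_simple s -> integrable_simple t -> integrable_simple (a *: s + t).
Proof.
move=> [ss sfin] [ts tfin].
have st : simple (a *: s + t) by exact: (simple_op (fun x y => a *: x + y)).
have m (u : T -> X) : simple u -> measurable [set w | u w <> 0].
  exact: (simple_preimage [set x | x <> 0]).
split => //; apply: (@le_lt_trans _ _
    (mu [set w | s w <> 0%R] + mu [set w | t w <> 0%R])%E); last exact: lte_add_pinfty.
apply: le_trans (measureU2 _ _ _); [|exact: m|exact: m].
apply: le_measure; rewrite ?inE; [exact: m|by apply: measurableU; exact: m|].
move=> w /= nz; apply: contrapT => /not_orP[/contrapT sw /contrapT tw].
by apply: nz; have -> : (a *: s + t) w = a *: s w + t w by []; rewrite sw tw scaler0 addr0.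
Qed.

Lemma int_norm_simple (s : T -> X) :
  integrable_simple s -> (int_norm s < +oo)%E.
Proof.
move=> [ss sfin]; have [fs _] := ss.
have ms : measurable [set w | s w <> 0].
  exact: (simple_preimage [set x | x <> 0]).
have /finite_seqP[r rE] := fs; pose M := \sum_(x <- r) rnorm x.
have M0 : 0 <= M by apply: sumr_ge0 => x _; exact: rnorm_ge0.
apply: (@le_lt_trans _ _ (\int[mu]_w (M%:E * (\1_[set w | s w <> 0%R] w)%:E)%E)%E).
  apply: ae_ge0_integral_le => [w|w|].
  - by rewrite lee_fin rnorm_ge0.
  - by rewrite mule_ge0 ?lee_fin.
  apply/nearW => w; rewrite -EFinM lee_fin indicE.
  case: (boolP (w \in [set w | s w <> 0])) => [_|]; last first.
    rewrite notin_setE /= => /contrapT ->; by rewrite rnorm0 mulr0.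
  have sw : s w \in r.
    by have : range s (s w) by []; rewrite rE.
  rewrite mulr1 /M (big_rem (s w)) //= lerDl; apply: sumr_ge0 => x _.
  exact: rnorm_ge0.
rewrite ge0_integralZl//; last by apply/measurable_EFinP; exact: measurable_indic.
rewrite integral_indic// setIT.
by apply: lte_mul_pinfty.
Qed.

Lemma bochner_integrable_lin (a : R[i]) f g :
  bochner_integrable f -> bochner_integrable g -> bochner_integrable (a *: f + g).
Proof.
move=> [mf [s [ss sf]]] [mg [t [ts tg]]]; split.
  exact: strongly_measurable_lin.
exists (fun n => a *: s n + t n); split.
  by move=> n; exact: integrable_simple_lin.
have msub (u v : T -> X) : strongly_measurable u -> simple v ->
    strongly_measurable (u - v).
  move=> mu' sv.
  have -> : u - v = (-1) *: v + u by rewrite scaleN1r addrC.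
  by apply: strongly_measurable_lin => //; exact: strongly_measurable_simple.
have ub : ((complex.Re `|a|)%:E * int_norm (f - s n)%R + int_norm (g - t n)%R)%E
    @[n --> \oo] --> 0%E.
  have -> : 0%E = ((complex.Re `|a|)%:E * 0 + 0)%E :> \bar R by rewrite mule0 adde0.
  by apply: cvgeD; [rewrite mule0|exact: cvgeZl|exact: tg].
apply: (@squeeze_cvge _ _ _ _ (cst 0%E) _ _ _ _ (cvg_cst _) ub).
apply: nearW => n; rewrite integral_ge0 /=; last first.
  by move=> w _; rewrite lee_fin rnorm_ge0.
apply: le_trans (int_norm_lin a (msub _ _ mf (ss n).1) (msub _ _ mg (ts n).1)).
rewrite le_eqVlt; apply/orP; left; apply/eqP; apply: eq_integral => w _.
congr (rnorm _)%:E; rewrite !fctE /= scalerBr opprD.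
by rewrite addrACA.
Qed.

Lemma bochner_integrable0 : bochner_integrable (0 : T -> X).
Proof.
have s0 : simple (0 : T -> X).
  split=> [|y].
    by apply: sub_finite_set (finite_set1 (0 : X)) => _ [w _ <-].
  by rewrite preimage_cst; case: ifP.
split; first exact: strongly_measurable_simple.
exists (fun=> 0); split.
  move=> n; split => //.
  by rewrite (_ : [set _ | _] = set0) ?measure0//; apply/seteqP; split => w.
rewrite integral0_eq; first exact: cvg_cst.
by move=> w _; rewrite subrr rnorm0.
Qed.

Lemma int_norm_fin f : bochner_integrable f -> int_norm f \is a fin_num.
Proof.
move=> [mf [s [ss sf]]]; rewrite ge0_fin_numE ?int_norm_ge0//.
have /fine_cvgP[/= [n _ /(_ n (leqnn n)) fin] _] := sf.
have msn := strongly_measurable_simple (ss n).1.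
have mfs : strongly_measurable (f - s n).
  have -> : f - s n = (-1) *: s n + f by rewrite scaleN1r addrC.
  exact: strongly_measurable_lin.
have -> : f = 1 *: (f - s n) + s n by rewrite scale1r subrK.
apply: le_lt_trans (int_norm_lin 1 mfs msn) _.
apply: lte_add_pinfty; last exact: int_norm_simple.
apply: lte_mul_pinfty; rewrite ?lee_fin ?normr1//.
by move: fin; rewrite ge0_fin_numE// integral_ge0// => w _; rewrite lee_fin rnorm_ge0.
Qed.

End bochner.

Section L1_space.
Context {R : realType} {d : measure_display} {T : measurableType d}.
Variable mu : {measure set T -> \bar R}.
Variable X : normedModType R[i].

Definition bochner_pred : {pred T -> X} :=
  fun f => `[< bochner_integrable mu f >].

Record bochner := Bochner {
  bochner_fun :> T -> X ;
  bochner_funP : bochner_fun \in bochner_pred }.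

HB.instance Definition _ := [isSub for bochner_fun].
HB.instance Definition _ := [Choice of bochner by <:].

Lemma bochner_submod_closed : submod_closed bochner_pred.
Proof.
split; first exact/asboolP/bochner_integrable0.
move=> a f g /asboolP bf /asboolP bg.
by apply/asboolP; exact: bochner_integrable_lin.
Qed.

HB.instance Definition _ :=
  GRing.isSubmodClosed.Build R[i] (T -> X) bochner_pred bochner_submod_closed.
HB.instance Definition _ := [SubChoice_isSubLmodule of bochner by <:].

Lemma bochnerP (f : bochner) : bochner_integrable mu f.
Proof. exact/asboolP/bochner_funP. Qed.

(* L1 is the quotient of the space of Bochner integrable functions by the
   subspace of functions vanishing mu-a.e. (see L1class_eq), normed by the
   integral of the norm (see L1_normE). *)
Definition ae_zero : {pred bochner} :=
  fun f => `[< {ae mu, forall w, f w = 0} >].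

Lemma ae_zero_zmod_closed : zmod_closed ae_zero.
Proof.
split; first by apply/asboolP/nearW.
move=> f g /asboolP f0 /asboolP g0; apply/asboolP.
by apply: filterS2 f0 g0 => w f0 g0; rewrite /= !fctE f0 g0 subr0.
Qed.

HB.instance Definition _ :=
  GRing.isZmodClosed.Build bochner ae_zero ae_zero_zmod_closed.

Definition L1 := Quotient.quot ae_zero.

HB.instance Definition _ := Choice.on L1.
HB.instance Definition _ := GRing.Zmodule.on L1.

Definition L1class (f : bochner) : L1 := \pi_(Quotient.quot ae_zero) f.

Lemma L1class_eq (f g : bochner) :
  L1class f = L1class g <-> {ae mu, forall w, f w = g w}.
Proof.
split.
  move=> /eqP; rewrite /L1class -Quotient.idealrBE => /asboolP.
  by apply: filterS => w /= /eqP; rewrite subr_eq0 => /eqP.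
move=> fg; apply/eqP; rewrite /L1class -Quotient.idealrBE; apply/asboolP.
by apply: filterS fg => w fg; apply/eqP; rewrite subr_eq0; apply/eqP.
Qed.

Definition L1repr (u : L1) : bochner := repr u.

Lemma L1reprK : cancel L1repr L1class.
Proof. by move=> u; exact: reprK. Qed.

Lemma L1classK (f : bochner) : {ae mu, forall w, L1repr (L1class f) w = f w}.
Proof. by apply/L1class_eq; rewrite L1reprK. Qed.

Lemma L1classD (f g : bochner) : L1class (f + g) = L1class f + L1class g.
Proof. exact: raddfD. Qed.

Definition L1scale (a : R[i]) (u : L1) : L1 := L1class (a *: L1repr u).

Lemma L1scale_class (a : R[i]) (f : bochner) :
  L1scale a (L1class f) = L1class (a *: f).
Proof.
apply/L1class_eq; apply: filterS (L1classK f) => w fw.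
by rewrite -[LHS]/(a *: L1repr (L1class f) w) fw.
Qed.

Lemma L1scaleA a b u : L1scale a (L1scale b u) = L1scale (a * b) u.
Proof. by rewrite -(L1reprK u) !L1scale_class scalerA. Qed.

Lemma L1scale1 : left_id 1 L1scale.
Proof. by move=> u; rewrite -(L1reprK u) L1scale_class scale1r. Qed.

Lemma L1scaleDr : right_distributive L1scale +%R.
Proof.
move=> a u v; rewrite -(L1reprK u) -(L1reprK v) -L1classD !L1scale_class.
by rewrite scalerDr L1classD.
Qed.

Lemma L1scaleDl u : {morph L1scale^~ u : a b / a + b}.
Proof.
by move=> a b; rewrite -(L1reprK u) !L1scale_class scalerDl L1classD.
Qed.

HB.instance Definition _ := GRing.Zmodule_isLmodule.Build R[i] L1
  L1scaleA L1scale1 L1scaleDr L1scaleDl.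

Lemma L1classZ (a : R[i]) (f : bochner) : L1class (a *: f) = a *: L1class f.
Proof. by rewrite -[RHS]/(L1scale a _) L1scale_class. Qed.

Definition L1norm (u : L1) : R[i] := (fine (int_norm mu (L1repr u)))%:C.

Lemma L1norm_class (f : bochner) : L1norm (L1class f) = (fine (int_norm mu f))%:C.
Proof. by rewrite /L1norm (int_norm_ae (L1classK f)). Qed.

Lemma L1norm_triangle u v : L1norm (u + v) <= L1norm u + L1norm v.
Proof.
rewrite -(L1reprK u) -(L1reprK v) -L1classD !L1norm_class -rmorphD lecR.
have [bu bv] := (bochnerP (L1repr u), bochnerP (L1repr v)).
have [fu fv] := (int_norm_fin bu, int_norm_fin bv).
have fuv := int_norm_fin (bochnerP (L1repr u + L1repr v)).
rewrite -fineD//; apply: fine_le => //; first by rewrite fin_numD fu.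
have := int_norm_lin 1 bu.1 bv.1.
by rewrite scale1r normr1 mul1e.
Qed.

Lemma L1normZ (a : R[i]) u : L1norm (a *: u) = `|a| * L1norm u.
Proof.
rewrite -(L1reprK u) -L1classZ !L1norm_class.
have bu := bochnerP (L1repr u).
rewrite (int_normZ a bu.1) fineM ?int_norm_fin// rmorphM; congr (_ * _).
Qed.

Lemma L1norm_eq0 u : L1norm u = 0 -> u = 0.
Proof.
rewrite -(L1reprK u) L1norm_class => /complexI u0.
have bu := bochnerP (L1repr u).
have : int_norm mu (L1repr u) = 0%E by rewrite -[LHS]fineK ?int_norm_fin// u0.
move=> /(int_norm_eq0 bu.1) ae0.
by rewrite -(raddf0 (\pi_(Quotient.quot ae_zero))); exact/L1class_eq.
Qed.

HB.instance Definition _ := Lmodule_isNormed.Build R[i] L1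
  L1norm_triangle L1normZ L1norm_eq0.

Lemma L1_normE (f : bochner) :
  rnorm (L1class f) = fine (\int[mu]_w (rnorm (f w))%:E)%E.
Proof. by rewrite -[rnorm _]/(complex.Re (L1norm _)) L1norm_class. Qed.

End L1_space.

(* Main.v *)
Require Import Defs.
From HB Require Import structures.
From mathcomp Require Import all_boot all_order all_algebra.
From mathcomp Require Import all_classical all_reals all_analysis.
From mathcomp.real_closed Require Import complex.
From mathcomp Require Import measurable_realfun ess_sup_inf ring lra.

(** For each vector x the set function E |-> Re phi(1_E x), on the sets of finite
    measure, is additive and bounded by ||phi|| ||x|| mu(E), so by Radon-Nikodym
    it has a density k_x with |k_x| <= ||phi|| ||x|| everywhere.  The map
    x |-> k_x is real linear only up to null sets that depend on the vectors;
    since X need not be separable, the densities must be modified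
    simultaneously, uncountably many at a time, to become linear at every point.
    This is what liftings of L^infty(mu) are used for, and a lifting is
    constructed here in the form of a family of ultrafilters.

    [density_ultrafilters mu U] says that each U w is an ultrafilter containing
    all conull sets, and that a measurable set E belongs to U w for almost every
    w in E.  The limit of a bounded function f along U w then depends only on
    the class of f, is linear and monotone in f, and equals f w almost
    everywhere when f is measurable ([density_filter_cvg]).  Such families exist
    by Zorn's lemma on pairs made of a sub-sigma-algebra B and, for each w, a
    filter base of non-null members of B ([density_base]).  One set can be
    adjoined to B ([density_base_adjoin]); a chain without countable cofinal
    subset has its union as an upper bound; and the limit of an increasing
    sequence B_n is the step where the almost sure convergence of the
    conditional probabilities P(E | B_n) to the indicator of E is needed
    ([density_base_lim]).  The conditional probabilities themselves do not
    appear: all that is used of them is where they exceed 1 - e, and Hahn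
    decompositions relative to B_n provide these sets ([Hahn_density]).

    With l_w(x) = lim_{U w} k_x one puts g(w)(x) = l_w(x) - i l_w(i x), which is
    complex linear with real part l_w ([dual_of_real]).  For each fixed x,
    l_w(x) = k_x(w) almost everywhere; this gives the w*-measurability of g and,
    first for simple f and then by density in L^1, the integral formula.  For the
    norm, countably many vectors x_n of the unit ball give the essential supremum
    F = sup_n k_{x_n} of all the k_x with x in the ball ([ess_sup_countable]);
    for almost every w, k_x <= F on a conull set gives
    l_w(x) <= lim_{U w} F = F(w) for all x at once, so that ||g|| = F almost
    everywhere ([dual_norm_g_measurable]).  The equality of norms follows
    from ||g(w)|| <= ||phi|| and |phi(f)| <= || ||g|| ||_oo ||f||_1. *)

Set Implicit Arguments.
Unset Strict Implicit.
Unset Printing Implicit Defensive.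
Import Order.TTheory GRing.Theory Num.Theory.
Import numFieldNormedType.Exports.
Local Open Scope classical_set_scope.
Local Open Scope ring_scope.

(** * Sub-sigma-algebras of a finite measure space *)

Section sigma_algebra_closure.
Context {T : Type} {B : set (set T)}.
Hypothesis sB : sigma_algebra setT B.

Lemma salgC E : B E -> B (~` E).
Proof. by move=> BE; rewrite -setTD; case: sB => _ + _; exact. Qed.

Lemma salgT : B setT.
Proof. by rewrite -setC0; apply: salgC; case: sB. Qed.

Lemma salgI E F : B E -> B F -> B (E `&` F).
Proof. by move: E F; case/sigma_algebraP: (sB). Qed.

Lemma salgD E F : B E -> B F -> B (E `\` F).
Proof. by move=> BE /salgC; exact: salgI. Qed.

Lemma salgU E F : B E -> B F -> B (E `|` F).
Proof.
by move=> /salgC BE /salgC BF; rewrite -[_ `|` _]setCK setCU; exact/salgC/salgI.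
Qed.

End sigma_algebra_closure.

Section finite_measure.
Context {R : realType} {d : measure_display} {T : measurableType d}.
Variable P : {finite_measure set T -> \bar R}.
Local Open Scope ereal_scope.

(** The union of a sequence along which the measure tends to its supremum over
    [Z] cannot be enlarged by a non-null set. *)
Lemma essentially_largest (Z : set (set T)) :
  Z `<=` measurable -> Z !=set0 ->
  (forall F : (set T)^nat, (forall n, Z (F n)) -> Z (\bigcup_n F n)) ->
  exists2 M, Z M & forall G, Z G -> P (G `\` M) = 0.
Proof.
move=> Zm [Z0 ZZ0] Zcup; pose S := [set P G | G in Z].
have SN0 : S != set0 by apply/set0P; exists (P Z0); exists Z0.
have [u uS ucvg] := ereal_sup_seq SN0.
have [F FP] := @choice _ _ (fun n G => Z G /\ P G = u n) (fun n =>
  let: ex_intro2 G ZG e := uS n in ex_intro _ G (conj ZG e)).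
set M := \bigcup_n F n; have ZM : Z M by apply: Zcup => n; have [] := FP n.
exists M => // G ZG.
have [mM mG] := (Zm _ ZM, Zm _ ZG).
have supM : ereal_sup S <= P M.
  rewrite -(cvg_lim _ ucvg)//; apply: lime_le.
    by apply/cvg_ex; eexists; exact: ucvg.
  apply: nearW => n; have [ZF <-] := FP n.
  by apply: le_measure; rewrite ?inE//; [exact: Zm|exact: bigcup_sup].
have : P (M `|` G) <= P M.
  apply: le_trans supM; apply: ereal_sup_ubound; exists (M `|` G) => //.
  pose F2 n := if n is 0%N then M else G.
  have -> : M `|` G = \bigcup_n F2 n.
    apply/seteqP; split => x; first by case=> ?; [exists 0%N|exists 1%N].
    by case=> -[|n] _ ?; [left|right].
  by apply: Zcup => -[|n].
have -> : M `|` G = M `|` (G `\` M) by rewrite setUDr setDv setD0.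
have mGM : measurable (G `\` M) by exact: measurableD.
rewrite measureU//; last by rewrite setDE setICA setICr setI0.
rewrite -[leRHS]adde0 leeD2lE ?fin_num_measure// => h.
by apply/eqP; rewrite eq_le h measure_ge0.
Qed.

(** A version of the set where the conditional probability of [E] given [B] is
    at least [1 - e]: the positive part, for the Hahn decomposition relative to
    [B], of the charge [H |-> e P(H) - P(H minus E)]. *)
Lemma Hahn_density (B : set (set T)) (E : set T) (e : R) :
  sigma_algebra setT B -> B `<=` measurable -> measurable E ->
  exists2 M, B M & (forall H, B H -> H `<=` M -> P (H `\` E) <= e%:E * P H) /\
    (forall H, B H -> H `&` M = set0 -> e%:E * P H <= P (H `\` E)).
Proof.
move=> sB Bm mE.
have BE : B.-sigma.-measurable = B by exact: measurable_g_measurableTypeE.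
have mB (H : set (g_sigma_algebraType B)) : measurable H -> @measurable _ T H.
  by rewrite BE; exact: Bm.
pose nu (H : set (g_sigma_algebraType B)) : \bar R := e%:E * P H - P (H `\` E).
have nu0 : nu set0 = 0 by rewrite /nu set0D !measure0 mule0 sube0.
have finP H : measurable H -> P H \is a fin_num by exact: fin_num_measure.
have mBE H : measurable (H : set (g_sigma_algebraType B)) ->
  @measurable _ T (H `\` E) by move=> /mB mH; exact: measurableD.
have nufin H : measurable H -> nu H \is a fin_num.
  by move=> mH; rewrite fin_numB fin_numM//= ?finP//; [exact: mBE|exact: mB].
have nusig : semi_sigma_additive nu.
  move=> F mF tF mUF.
  have cP : (fun n => \sum_(0 <= i < n) P (F i)) @ \oo --> P (\bigcup_n F n).
    apply: measure_semi_sigma_additive => //; [move=> n; exact: mB|exact: mB].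
  have cPE : (fun n => \sum_(0 <= i < n) P (F i `\` E)) @ \oo -->
      P (\bigcup_n F n `\` E).
    rewrite setD_bigcupl; apply: measure_semi_sigma_additive.
    - by move=> n; exact: mBE.
    - apply/trivIsetP => i j _ _ ij; move/trivIsetP : tF => /(_ i j I I ij) tF.
      by rewrite setDE setDE setIACA tF set0I.
    - by rewrite -setD_bigcupl; exact: mBE.
  have -> : (fun n => \sum_(0 <= i < n) nu (F i)) =
      (fun n => e%:E * (\sum_(0 <= i < n) P (F i)) -
         \sum_(0 <= i < n) P (F i `\` E)).
    apply/funext; elim=> [|n IH]; first by rewrite !big_geq// mule0 sube0.
    rewrite !big_nat_recr//= IH /nu muleDr//; last first.
      by rewrite ge0_adde_def// inE ?sume_ge0.
    rewrite fin_num_oppeD ?finP//; last exact: mBE.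
    by rewrite addeACA.
  apply: cvgeB => //.
  - rewrite fin_num_adde_defl// fin_numN finP//; exact: mBE.
  - exact: cvgeZl.
pose nuC := isCharge.Build _ _ _ nu nu0 nufin nusig.
pose nu' : {charge set (g_sigma_algebraType B) -> \bar R} := HB.pack nu nuC.
have [M [N [[mM Mpos] [mN Nneg] MN _]]] := Hahn_decomposition nu'.
have BM : B M by rewrite -BE.
exists M => //; split => H BH HM.
  have : 0 <= nu' H by apply: Mpos => //; rewrite BE.
  rewrite /= /nu sube_ge0//; apply/orP; left.
  by apply: finP; apply: measurableD => //; exact: Bm.
have HN : H `<=` N.
  move=> x Hx; have : (M `|` N) x by rewrite MN.
  by case=> // Mx; exfalso; rewrite -[False]/(set0 x) -HM.
have : nu' H <= 0 by apply: Nneg => //; rewrite BE.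
by rewrite /= /nu sube_le0//.
Qed.

(** The sets that can be approximated in measure form a lambda-system, and the
    increasing union of the [B n] is stable under intersection. *)
Lemma sigma_bigcup_approx (B : nat -> set (set T)) (E : set T) (e : R) :
  (forall n, sigma_algebra setT (B n)) -> (forall n, B n `<=` measurable) ->
  {homo B : n m / (n <= m)%N >-> n `<=` m} ->
  <<s \bigcup_n B n >> E -> (0 < e)%R ->
  exists n, exists2 F, B n F & P (E `+` F) < e%:E.
Proof.
move=> sB Bm Bh BE; move: e.
suff [] : [set E | measurable E /\ forall e : R, (0 < e)%R ->
  exists n, exists2 F, B n F & P (E `+` F) < e%:E] E by [].
have Bmax n m F : B n F -> B (maxn n m) F /\ B (maxn m n) F.
  by split; [exact: Bh (leq_maxl _ _) _ _|exact: Bh (leq_maxr _ _) _ _].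
have BI : setI_closed (\bigcup_n B n).
  move=> E1 E2 [n _ nE1] [m _ mE2]; exists (maxn n m) => //.
  by apply: salgI => //; [exact: (Bmax _ _ _ nE1).1|exact: (Bmax _ _ _ mE2).2].
have mYn n F E' : measurable E' -> B n F -> measurable (E' `+` F).
  by move=> mE' /Bm mF; rewrite setY_def; apply: measurableU; apply: measurableD.
apply: (lambda_system_subset BI (D := setT)) => //.
- split=> //.
  + split; first exact: measurableT.
    move=> e e0; exists 0%N, setT; last by rewrite setYK measure0 lte_fin.
    exact: salgT.
  + move=> E1 E2 E21 [mE1 aE1] [mE2 aE2]; split; first exact: measurableD.
    move=> e e0; have e20 : (0 < e / 2)%R by rewrite divr_gt0.
    have [n [F1 F1n PF1]] := aE1 _ e20.
    have [m [F2 F2m PF2]] := aE2 _ e20.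
    have BF : B (maxn n m) (F1 `\` F2).
      by apply: salgD => //; [exact: (Bmax _ _ _ F1n).1|exact: (Bmax _ _ _ F2m).2].
    exists (maxn n m), (F1 `\` F2) => //.
    rewrite [e]splitr EFinD; apply: le_lt_trans (lteD PF1 PF2).
    apply: le_trans (measureU2 _ (mYn _ _ _ mE1 F1n) (mYn _ _ _ mE2 F2m)).
    apply: le_measure; rewrite ?inE.
    * by apply: mYn BF; exact: measurableD.
    * by apply: measurableU; [exact: mYn F1n|exact: mYn F2m].
    * move=> x; rewrite !setY_def /=.
      have [|] := pselect (E1 x); have [|] := pselect (E2 x);
        by have [|] := pselect (F1 x); have [|] := pselect (F2 x); tauto.
  + move=> F Fnd FH; split; first by apply: bigcup_measurable => k _; have [] := FH k.
    move=> e e0; have e20 : (0 < e / 2)%R by rewrite divr_gt0.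
    pose U := \bigcup_n F n.
    have mF k : measurable (F k) by have [] := FH k.
    have mU : measurable U by exact: bigcup_measurable.
    have mD k : measurable (U `\` F k) by exact: measurableD.
    have cap0 : \bigcap_n (U `\` F n) = set0.
      by apply/seteqP; split => // x h; have [[n _ Fnx] _] := h 0%N I; have [_] := h n I.
    have : (P \o (fun n => U `\` F n)) x @[x --> \oo] --> P (\bigcap_n (U `\` F n)).
      apply: nonincreasing_cvg_mu => //.
      - by rewrite -ge0_fin_numE// fin_num_measure.
      - by rewrite cap0.
      - move=> n m nm; apply/subsetPset; apply: setDS; apply/subsetPset; exact: Fnd.
    rewrite cap0 measure0 => /fine_cvgP[_ /cvgrPdist_lt/(_ _ e20)[N _ /(_ N (leqnn N))]].
    rewrite /= sub0r normrN ger0_norm ?fine_ge0// => PN.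
    have [n [G BG PG]] := (FH N).2 _ e20.
    exists n, G => //.
    have PN' : P (U `\` F N) < (e / 2)%:E by rewrite -[P _]fineK ?fin_num_measure// lte_fin.
    rewrite [e]splitr EFinD; apply: le_lt_trans (lteD PN' PG).
    apply: le_trans (measureU2 _ (mD N) (mYn _ _ _ (mF N) BG)).
    apply: le_measure; rewrite ?inE.
    * exact: mYn BG.
    * by apply: measurableU; [exact: mD|exact: mYn BG].
    * have : F N `<=` U by exact: bigcup_sup.
      move=> FU x; have := FU x; rewrite !setY_def /=.
      by have [|] := pselect (F N x); have [|] := pselect (G x); tauto.
- move=> X [n _ BX]; split; first exact: Bm BX.
  by move=> e e0; exists n, X => //; rewrite setYK measure0 lte_fin.
Qed.

End finite_measure.

(** * Density bases *)

Section density_base.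
Context {R : realType} {d : measure_display} {T : measurableType d}.
Variable P : {finite_measure set T -> \bar R}.
Local Open Scope ereal_scope.

(** [Phi w] is a filter base made of sets of [B] that have density one at [w];
    [db_ae] is the analogue of the Lebesgue density theorem. *)
Record density_base (B : set (set T)) (Phi : T -> set (set T)) : Prop := {
  db_salg : sigma_algebra setT B ;
  db_meas : B `<=` measurable ;
  db_sub : forall w, Phi w `<=` B ;
  dbT : forall w, Phi w setT ;
  dbI : forall w E F, Phi w E -> Phi w F -> Phi w (E `&` F) ;
  db_pos : forall w E, Phi w E -> P E != 0 ;
  db_ae : forall E, B E -> {ae P, forall w, E w -> Phi w E} }.

Lemma density_base_trivial : P setT != 0 ->
  density_base [set E | E = set0 \/ E = setT] (fun _ => [set setT]).
Proof.
move=> PT; split=> //.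
- split; first by left.
  + by move=> E [->|->]; [right; rewrite setD0|left; rewrite setDT].
  + move=> F FP; have [[n Fn]|nF] := pselect (exists n, F n = setT).
      by right; apply/seteqP; split => // x _; exists n => //; rewrite Fn.
    left; apply/seteqP; split => // x [n _ Fnx].
    by case: (FP n) => Fn; [rewrite -Fn|exfalso; apply: nF; exists n].
- by move=> E [->|->].
- by move=> w E ->; right.
- by move=> w E F /= -> ->; rewrite setIT.
- by move=> w E /= ->.
- by move=> E [->|->]; apply: nearW.
Qed.

Section successor.
Variables (B : set (set T)) (Phi : T -> set (set T)) (A : set T).
Hypotheses (dB : density_base B Phi) (mA : measurable A).

(** Let [Z] be the essentially largest set of [B] with null trace on [A'].
    Almost every [w] in [A'] lies outside [Z], hence has the complement of [Z]
    in [Phi w], and this complement meets in a null set every [G] in [B] that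
    has a null trace on [A']. *)
Lemma density_base_meets (A' : set T) : measurable A' ->
  {ae P, forall w, A' w -> forall G, Phi w G -> P (G `&` A') != 0}.
Proof.
move=> mA'; have [sB Bm _ _ PI Ppos Pae] := dB.
have [||F FZ|Z [BZ Z0] Zmax] := @essentially_largest _ _ _ P [set G | B G /\ P (G `&` A') = 0].
- by move=> G [/Bm].
- by exists set0; split; [case: sB|rewrite set0I measure0].
- split; first by case: sB => _ _; apply => n; have [] := FZ n.
  rewrite setI_bigcupl; apply: measure_negligible.
    by apply: bigcup_measurable => k _; apply: measurableI => //; have [/Bm] := FZ k.
  apply: negligible_bigcup => k; have [/Bm mF F0] := FZ k.
  by apply/negligibleP => //; exact: measurableI.
have AZ : {ae P, forall w, ~ (Z `&` A') w}.
  exists (Z `&` A'); split => //; first by apply: measurableI => //; exact: Bm.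
  by move=> w /= /contrapT.
apply: filterS2 AZ (Pae _ (salgC sB BZ)) => w nZA /= PZ Aw G PG.
apply/eqP => GA0.
have /Zmax GZ0 : B G /\ P (G `&` A') = 0 by split => //; exact: (db_sub dB PG).
have /PZ/(PI _ _ _ PG)/Ppos : ~ Z w by move=> Zw; apply: nZA.
by rewrite -setDE GZ0 eqxx.
Qed.

(** The new base at [w] consists of the sets that contain some [G] of [Phi w]
    almost everywhere on [D w], where [D w] is whichever of [A] and its
    complement contains [w].  This keeps non-null members as soon as no [G] has
    a null trace on [D w], which by [density_base_meets] fails only for a null
    set of points; there [D w] is the whole space. *)
Lemma density_base_adjoin : exists B' Phi', [/\ density_base B' Phi',
  B `<=` B', B' A & forall w, Phi w `<=` Phi' w].
Proof.
have [sB Bm sub PT PI Ppos Pae] := dB.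
pose B' : set (set T) :=
  [set S | exists E F, [/\ B E, B F & S = (E `&` A) `|` (F `\` A)]].
have BB' : B `<=` B'.
  by move=> E BE; exists E, E; split => //; rewrite setUIDK.
have mB' : B' `<=` measurable.
  move=> _ [E [F [/Bm mE /Bm mF ->]]].
  by apply: measurableU; [exact: measurableI|exact: measurableD].
have sB' : sigma_algebra setT B'.
  split.
  - by apply: BB'; case: sB.
  - move=> _ [E [F [BE BF ->]]]; exists (~` E), (~` F); split; [exact: salgC|exact: salgC|].
    apply/seteqP; split => w; rewrite /setD /=;
      have [|] := pselect (A w); have [|] := pselect (E w);
        by have [|] := pselect (F w); tauto.
  - move=> S /(_ _)/cid; rewrite /B' /= => S'.
    pose E n := projT1 (S' n); pose F n := projT1 (cid (projT2 (S' n))).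
    have EF n : [/\ B (E n), B (F n) & S n = (E n `&` A) `|` (F n `\` A)].
      exact: projT2 (cid (projT2 (S' n))).
    case: (sB) => _ _ Bcup; exists (\bigcup_n E n), (\bigcup_n F n); split.
    + by apply: Bcup => n; have [] := EF n.
    + by apply: Bcup => n; have [] := EF n.
    + rewrite setI_bigcupl setD_bigcupl -bigcupU.
      by apply: eq_bigcupr => n _; have [] := EF n.
pose good D w := D w /\ forall G, Phi w G -> P (G `&` D) != 0.
pose D w := if pselect (good A w) then A
            else if pselect (good (~` A) w) then ~` A else setT.
have mD w : measurable (D w).
  rewrite /D; case: pselect => /= _; [|case: pselect => /= _] => //.
  exact: measurableC.
have Dpos w G : Phi w G -> P (G `&` D w) != 0.
  rewrite /D; case: pselect => /= [[_ h]|_]; first exact: h.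
  case: pselect => /= [[_ h]|_]; first exact: h.
  by rewrite setIT; exact: Ppos.
pose Phi' w := [set S | B' S /\ exists2 G, Phi w G & P ((G `&` D w) `\` S) = 0].
have mGD w G S : Phi w G -> B' S -> measurable ((G `&` D w) `\` S).
  move=> /sub/Bm mG /mB' mS; apply: measurableD => //; exact: measurableI.
have Phi'I w G S : B' S -> Phi w G -> G `&` D w `<=` S -> Phi' w S.
  move=> BS PG GS; split => //; exists G => //.
  by rewrite -setD_eq0 in GS; rewrite GS measure0.
exists B', Phi'; split => //; last first.
- move=> w E PE; apply: (Phi'I w E) => //; first exact/BB'/(sub w).
- exists setT, set0; rewrite setTI set0D setU0; split => //; first exact: salgT.
  by case: sB.
split => //.
- by move=> w E [].
- by move=> w; apply: (Phi'I w setT) => //; exact: salgT.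
- move=> w E F [BE [G PG G0]] [BF [G' PG' G'0]].
  split; first exact: salgI.
  exists (G `&` G'); first exact: PI.
  have -> : G `&` G' `&` D w `\` E `&` F =
     ((G `&` G' `&` D w) `\` E) `|` ((G `&` G' `&` D w) `\` F) by rewrite setDIr.
  have mGG := PI _ _ _ PG PG'.
  apply: measure_negligible; first by apply: measurableU; exact: mGD.
  apply: negligibleU.
    apply: (@negligibleS _ _ _ _ ((G `&` D w) `\` E));
      last by apply/negligibleP => //; exact: mGD.
    by move=> x /=; tauto.
  apply: (@negligibleS _ _ _ _ ((G' `&` D w) `\` F));
      last by apply/negligibleP => //; exact: mGD.
  by move=> x /=; tauto.
- move=> w S [BS [G PG G0]]; apply: contra (Dpos w G PG) => /eqP S0.
  apply/eqP; apply: measure_negligible.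
    by apply: measurableI => //; exact/Bm/(sub w).
  apply: (@negligibleS _ _ _ _ (((G `&` D w) `\` S) `|` S)).
    by move=> x Gx; have [|] := pselect (S x); [right|left].
  by apply: negligibleU; apply/negligibleP => //; [exact: mGD|exact: mB'].
- move=> _ [E [F [BE BF ->]]].
  have BS : B' ((E `&` A) `|` (F `\` A)) by exists E, F.
  have EF : {ae P, forall w, (E w -> Phi w E) /\ (F w -> Phi w F)}.
    by apply: filterS2 (Pae _ BE) (Pae _ BF) => w; split.
  apply: filterS3 (density_base_meets mA) (density_base_meets (measurableC mA)) EF.
  move=> w gA gA' [EP FP] Sw; case: Sw => -[Hw Aw].
    apply: (Phi'I w E _ BS (EP Hw)) => x; rewrite /D.
    by case: pselect => /= [_|[]]; [left|split => //; exact: gA].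
  apply: (Phi'I w F _ BS (FP Hw)) => x; rewrite /D; case: pselect => /= [[]//|_].
  by case: pselect => /= [_|[]]; [right|split => //; exact: gA'].
Qed.

End successor.
End density_base.

Section density_base_limit.
Context {R : realType} {d : measure_display} {T : measurableType d}.
Variable P : {finite_measure set T -> \bar R}.
Variables (B : nat -> set (set T)) (Phi : nat -> T -> set (set T)).
Hypothesis dB : forall n, density_base P (B n) (Phi n).
Hypothesis Bh : {homo B : n m / (n <= m)%N >-> n `<=` m}.
Hypothesis Phih : forall w, {homo Phi ^~ w : n m / (n <= m)%N >-> n `<=` m}.
Local Open Scope ereal_scope.

(** Levy's zero-one law, for sets [M n] outside which the conditional
    probability of [E] given [B n] is at most [1 - e].  Let [F] in [B N] be
    close to [E].  The points of [F] that leave [M n] at some time [n >= N] are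
    split according to the first such time; each piece is in [B n] and disjoint
    from [M n], so a fraction at least [e] of it is outside [E].  Summing up,
    the measure of these points is at most [P (F minus E) / e]. *)
Lemma eventually_dense (E : set T) (M : nat -> set T) (e : R) :
  (0 < e <= 1)%R -> <<s \bigcup_n B n >> E -> (forall n, B n (M n)) ->
  (forall n H, B n H -> H `&` M n = set0 -> e%:E * P H <= P (H `\` E)) ->
  {ae P, forall w, E w -> exists n, forall m, (n <= m)%N -> M m w}.
Proof.
move=> /andP[e0 e1] BE BM ME.
have sB n := db_salg (dB n); have Bm n := db_meas (dB n).
have sBoo : sigma_algebra setT <<s \bigcup_n B n >> by exact: smallest_sigma_algebra.
have mE : measurable E.
  move: BE; apply: smallest_sub; first exact: sigma_algebra_measurable.
  by move=> X [n _ /Bm].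
pose D := E `&` \bigcap_n \bigcup_(m in [set m | (n <= m)%N]) ~` M m.
have mD : measurable D.
  apply: measurableI => //; apply: bigcap_measurable => // n _.
  by apply: bigcup_measurable => m _; apply: measurableC; exact/(Bm m).
suff D0 : P D = 0.
  exists D; split => // w /= /not_implyP[Ew nM]; split => // n _.
  apply: contrapT => nD; apply: nM; exists n => m nm.
  by apply: contrapT => nMm; apply: nD; exists m.
have eD (r : R) : (0 < r)%R -> e%:E * P D <= r%:E.
  move=> r0; have r20 : (0 < r / 2)%R by rewrite divr_gt0.
  have [N [F BF PF]] := sigma_bigcup_approx P sB Bm Bh BE r20.
  have mF := Bm _ _ BF.
  (* seqDU G j: the points of F whose first exit is at time N + j *)
  pose G j := F `\` M (N + j)%N.
  have BG j : B (N + j)%N (G j).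
    by apply: salgD => //; apply: Bh BF; exact: leq_addr.
  have BSG j : B (N + j)%N (seqDU G j).
    apply: salgD => //; apply: (big_ind (B (N + j)%N)).
    - by have [] := sB (N + j)%N.
    - by move=> ? ?; exact: salgU.
    - by move=> i _; apply: Bh (BG i); rewrite leq_add2l ltnW.
  have mG j : measurable (G j) by exact: Bm (BG j).
  have mSG j : measurable (seqDU G j) by exact: Bm (BSG j).
  have DG : D `<=` (E `\` F) `|` \bigcup_j G j.
    move=> w [Ew DM]; have [Fw|nFw] := pselect (F w); last by left.
    have [m /= Nm Mm] := DM N I.
    by right; exists (m - N)%N => //; split => //; rewrite subnKC.
  have mUG : measurable (\bigcup_j G j) by exact: bigcup_measurable.
  have ePG : e%:E * P (\bigcup_j G j) <= P (F `\` E).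
    have -> : P (\bigcup_j G j) = \sum_(0 <= j <oo) P (seqDU G j).
      rewrite seqDU_bigcup_eq measure_bigcup//.
      by apply: eq_eseriesl => j; rewrite in_setT.
    rewrite -nneseriesZl//.
    apply: (@le_trans _ _ (\sum_(0 <= j <oo) P (seqDU G j `\` E))).
      apply: lee_nneseries => [j _ _|j _]; first by rewrite mule_ge0// lee_fin ltW.
      apply: ME (BSG j) _.
      by apply/seteqP; split => // w [[[_ ?] _] ?].
    have -> : \sum_(0 <= j <oo) P (seqDU G j `\` E) = P (\bigcup_j (seqDU G j `\` E)).
      rewrite measure_bigcup//.
      - by apply: eq_eseriesl => j; rewrite in_setT.
      - by move=> j _; exact: measurableD.
      - apply/trivIsetP => i j _ _ ij.
        have /trivIsetP/(_ i j I I ij) tG := trivIset_seqDU G.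
        by rewrite setDE setDE setIACA tG set0I.
    apply: le_measure; rewrite ?inE.
    - by apply: bigcup_measurable => j _; exact: measurableD.
    - exact: measurableD.
    - by move=> w [j _ [[[Fw _] _] nE]].
  have mY : measurable (E `+` F) by rewrite setY_def; apply: measurableU; exact: measurableD.
  have PEF : P (E `\` F) <= P (E `+` F).
    apply: le_measure; rewrite ?inE//; first exact: measurableD.
    by rewrite setY_def; exact: subsetUl.
  have PFE : P (F `\` E) <= P (E `+` F).
    apply: le_measure; rewrite ?inE//; first exact: measurableD.
    by rewrite setY_def; exact: subsetUr.
  have PD : P D <= P (E `\` F) + P (\bigcup_j G j).
    have mEF : measurable (E `\` F) by exact: measurableD.
    apply: le_trans (measureU2 _ mEF mUG).
    by apply: le_measure; rewrite ?inE//; exact: measurableU.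
  rewrite [r]splitr EFinD.
  apply: (@le_trans _ _ (e%:E * P (E `\` F) + e%:E * P (\bigcup_j G j))).
    by rewrite -ge0_muleDr// lee_wpmul2l// lee_fin ltW.
  apply: leeD; last exact: le_trans ePG (le_trans PFE (ltW PF)).
  apply: le_trans (le_trans PEF (ltW PF)).
  by rewrite -[leRHS]mul1e lee_wpmul2r// lee_fin.
have : e%:E * P D <= 0 by apply/lee_addgt0Pr => r r0; rewrite add0e; exact: eD.
rewrite pmule_rle0 ?lte_fin// => PD0.
by apply/eqP; rewrite eq_le PD0 measure_ge0.
Qed.

(** The new base at [w] consists of the sets [E] whose conditional probability
    given [B m] is at least [1 - e] on some member of [Phi m w], for every [e] and
    all large [m].  Expressed through [P (H minus E) <= e P(H)] for the [H]
    contained in that member, this is stable under intersection by subadditivity,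
    and [eventually_dense] gives it for almost every point of [E]. *)
Lemma density_base_lim : exists B' Phi', [/\ density_base P B' Phi',
  forall n, B n `<=` B' & forall n w, Phi n w `<=` Phi' w].
Proof.
have sB n := db_salg (dB n); have Bm n := db_meas (dB n).
pose B' := <<s \bigcup_n B n >>.
have sB' : sigma_algebra setT B' by exact: smallest_sigma_algebra.
have BB' n : B n `<=` B' by move=> E BE; apply: sub_sigma_algebra; exists n.
have mB' : B' `<=` measurable.
  apply: smallest_sub; first exact: sigma_algebra_measurable.
  by move=> X [n _ /Bm].
pose dense m G E (e : R) := forall H, B m H -> H `<=` G -> P (H `\` E) <= e%:E * P H.
pose Phi' w := [set E | B' E /\ forall e : R, (0 < e)%R ->
  exists n, forall m, (n <= m)%N -> exists2 G, Phi m w G & dense m G E e].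
have PhiPhi' n w : Phi n w `<=` Phi' w.
  move=> E PE; split; first exact: BB' (db_sub (dB n) PE).
  move=> e e0; exists n => m nm; exists E; first exact: Phih PE.
  by move=> H _; rewrite -setD_eq0 => ->; rewrite measure0 mule_ge0// lee_fin ltW.
exists B', Phi'; split => //; split => //.
- by move=> w E [].
- by move=> w; apply: (PhiPhi' 0%N); exact: dbT (dB 0%N) w.
- move=> w E F [BE dE] [BF dF]; split; first exact: (salgI sB' BE BF).
  move=> e e0; have e20 : (0 < e / 2)%R by rewrite divr_gt0.
  have [n hn] := dE _ e20; have [n' hn'] := dF _ e20.
  exists (maxn n n') => m; rewrite geq_max => /andP[/hn[G PG dG] /hn'[G' PG' dG']].
  exists (G `&` G'); first by apply: (dbI (dB m)).
  move=> H BH; rewrite subsetI => -[HG HG']; rewrite setDIr [e]splitr EFinD.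
  rewrite ge0_muleDl ?lee_fin; [|exact: ltW|exact: ltW].
  have mH := Bm _ _ BH.
  apply: le_trans (leeD (dG _ BH HG) (dG' _ BH HG')).
  by apply: measureU2; apply: measurableD => //; exact: mB'.
- move=> w E [BE dE]; apply/eqP => E0.
  have e20 : (0 < 2^-1 :> R)%R by rewrite invr_gt0.
  have [n /(_ n (leqnn n))[G PG]] := dE _ e20.
  have BG := db_sub (dB n) PG; move/(_ G BG (@subset_refl _ G)).
  have mG := Bm _ _ BG; have mE := mB' _ BE.
  have -> : P (G `\` E) = P G.
    rewrite measureD//; last by rewrite -ge0_fin_numE// fin_num_measure.
    rewrite [X in _ - X](_ : _ = 0) ?sube0//.
    by apply: subset_measure0 E0 => //; exact: measurableI.
  have := db_pos (dB n) PG; rewrite -[P G]fineK ?fin_num_measure//.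
  move: (fine_ge0 (measure_ge0 P G)); move: (fine _) => p p0 pn0.
  rewrite -EFinM lee_fin; apply/negP; rewrite -ltNge.
  by rewrite gtr_pMl ?invf_lt1// ?ltr1n// lt_neqAle p0 eq_sym -eqe pn0.
- move=> E BE; have mE := mB' _ BE; pose r k : R := (k.+1%:R^-1)%R.
  have [M HM] : exists M : nat -> nat -> set T, forall k m, B m (M k m) /\
      dense m (M k m) E (r k) /\
      forall H, B m H -> H `&` M k m = set0 -> (r k)%:E * P H <= P (H `\` E).
    have /choice[M HM] : forall km : nat * nat, exists M, B km.2 M /\
      dense km.2 M E (r km.1) /\
      forall H, B km.2 H -> H `&` M = set0 -> (r km.1)%:E * P H <= P (H `\` E).
      move=> [k m] /=; have [M BM [h1 h2]] := Hahn_density P (r k) (sB m) (@Bm m) mE.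
      by exists M.
    by exists (fun k m => M (k, m)) => k m; exact: HM (k, m).
  have ev k : {ae P, forall w, E w -> exists n, forall m, (n <= m)%N -> M k m w}.
    apply: (@eventually_dense _ _ (r k)) => //.
    - by rewrite invr_gt0 ltr0n/= invf_le1// ler1n.
    - by move=> m; have [] := HM k m.
    - by move=> m; have [_ []] := HM k m.
  have PM : {ae P, forall w, forall k m, M k m w -> Phi m w (M k m)}.
    apply/ae_foralln => k; apply/ae_foralln => m.
    by apply: (db_ae (dB m)); have [] := HM k m.
  apply: filterS2 (ae_foralln ev) PM => w evw PMw Ew; split => // e e0.
  have [k] := ltr_add_invr e0; rewrite add0r => ke.
  have [n nM] := evw k Ew; exists n => m /nM /PMw PMk; exists (M k m) => //.
  have [_ [dM _]] := HM k m; move=> H BH HMk.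
  by apply: le_trans (dM H BH HMk) _; rewrite lee_wpmul2r// lee_fin ltW.
Qed.

End density_base_limit.

(** * Ultrafilters of sets of density one *)

(** A lifting of the measure algebra of [mu]: along [U w] every bounded function
    has a limit, which depends only on its class. *)
Definition density_ultrafilters {R : realType} {d : measure_display}
    {T : measurableType d} (mu : {measure set T -> \bar R})
    (U : T -> set_system T) :=
  [/\ forall w, UltraFilter (U w),
      forall E : set T, {ae mu, forall w, E w} -> forall w, U w E &
      forall E : set T, measurable E -> {ae mu, forall w, E w -> U w E}].

Section density_ultrafilter.
Context {R : realType} {d : measure_display} {T : measurableType d}.
Variable P : {finite_measure set T -> \bar R}.
Local Open Scope ereal_scope.

(** A maximal density base lives on all measurable sets, as otherwise a set could
    be adjoined to it. *)
Lemma density_base_measurable : P setT != 0 ->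
  exists Phi, density_base P measurable Phi.
Proof.
move=> PT.
pose S := {x : set (set T) * (T -> set (set T)) | density_base P x.1 x.2}.
pose ext (x y : S) := (sval x).1 `<=` (sval y).1 /\
  forall w, (sval x).2 w `<=` (sval y).2 w.
have ext_refl x : ext x x by split => // w.
have ext_trans x y z : ext x y -> ext y z -> ext x z.
  by move=> [xy xy'] [yz yz']; split => [|w]; apply: subset_trans; eauto.
pose s0 : S := exist _ (_, _) (density_base_trivial PT).
have [||C totC|[[B Phi] dB] maxB] := @ZL_preorder S s0 (fun x y => `[< ext x y >]).
- by move=> x; exact/asboolP.
- by move=> x y z /asboolP xy /asboolP yz; apply/asboolP; exact: ext_trans yz.
- have {}totC x y : C x -> C y -> ext x y \/ ext y x.
    by move=> Cx Cy; case: (totC _ _ Cx Cy) => /asboolP; [left|right].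
  suff [t ubt] : exists t, forall s, C s -> ext s t.
    by exists t => s Cs; exact/asboolP/ubt.
  have [C0|/set0P[c0 Cc0]] := eqVneq C set0; first by exists s0; rewrite C0.
  have [bnd|unb] := pselect (forall f : nat -> S, (forall n, C (f n)) ->
      exists2 c, C c & forall n, ext (f n) c).
  + (* the union of the chain is a sigma-algebra, a sequence in it lying in a
       single element of the chain *)
    pose B' := \bigcup_(x in C) (sval x).1.
    pose Phi' w := \bigcup_(x in C) (sval x).2 w.
    have dB' : density_base P B' Phi'.
      split.
      * split.
        - by exists c0 => //; have [] := db_salg (svalP c0).
        - move=> E [x Cx xE]; exists x => //.
          by have [_ + _] := db_salg (svalP x); apply.
        - move=> F /(_ _)/cid2-/all_sig2[f Cf fF].
          have [c Cc fc] := bnd f Cf; exists c => //.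
          have [_ _] := db_salg (svalP c); apply => n.
          exact: (fc n).1 _ (fF n).
      * by move=> E [x _]; exact: (db_meas (svalP x)).
      * by move=> w E [x Cx xE]; exists x => //; exact: (db_sub (svalP x)) xE.
      * by move=> w; exists c0 => //; exact: (dbT (svalP c0)).
      * move=> w E F [x Cx xE] [y Cy yF].
        case: (totC _ _ Cx Cy) => -[_ xy].
          by exists y => //; apply: (dbI (svalP y)) => //; exact: xy.
        by exists x => //; apply: (dbI (svalP x)) => //; exact: xy.
      * by move=> w E [x Cx]; exact: (db_pos (svalP x)).
      * move=> E [x Cx /(db_ae (svalP x))]; apply: filterS => w /[apply] xE.
        by exists x.
    by exists (exist _ (B', Phi') dB') => x Cx; split => [E|w E] xE; exists x.
  + (* a sequence without upper bound in the chain is cofinal in it *)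
    have [f Cf fub] : exists2 f : nat -> S, (forall n, C (f n)) &
        forall c, C c -> exists n, ext c (f n).
      move/existsNP : unb => [f /not_implyP[Cf nub]]; exists f => // c Cc.
      have /existsNP[n nfc] : ~ forall n, ext (f n) c by move=> h; apply: nub; exists c.
      by exists n; case: (totC _ _ (Cf n) Cc).
    pose join x y := if pselect (ext x y) then y else x.
    have joinC x y : C x -> C y -> [/\ C (join x y), ext x (join x y) & ext y (join x y)].
      move=> Cx Cy; rewrite /join; case: pselect => /= [xy|nxy]; split => //.
      by case: (totC _ _ Cx Cy).
    pose h := fix h n := if n is m.+1 then join (h m) (f n) else f 0%N.
    have Ch n : C (h n).
      by elim: n => [|n IH] /=; [exact: Cf|have [] := joinC _ _ IH (Cf n.+1)].
    have hS n : ext (h n) (h n.+1) by have [] := joinC _ _ (Ch n) (Cf n.+1).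
    have fh n : ext (f n) (h n).
      by case: n => [|n] //=; have [] := joinC _ _ (Ch n) (Cf n.+1).
    have hh n m : (n <= m)%N -> ext (h n) (h m).
      move=> /subnK <-; elim: (m - n)%N => [//|k IH].
      by rewrite addSn; exact: ext_trans IH (hS _).
    have [||B' [Phi' [dB' BB' PP']]] := density_base_lim (fun n => svalP (h n)).
    * by move=> n m /hh[].
    * by move=> w n m /hh[_]; exact.
    * exists (exist _ (B', Phi') dB') => x Cx.
      have [n xf] := fub x Cx.
      apply: (ext_trans _ _ _ xf); apply: (ext_trans _ _ _ (fh n)).
      by split => // w; exact: PP'.
- exists Phi; rewrite (_ : measurable = B)//; apply/seteqP; split; last exact: db_meas dB.
  move=> A mA; have [B' [Phi' [dB' BB' B'A PP']]] := density_base_adjoin dB mA.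
  have /maxB/asboolP[+ _] :
    `[< ext (exist _ (B, Phi) dB) (exist _ (B', Phi') dB') >] by apply/asboolP.
  exact.
Qed.

(** The sets containing a member of [Phi w] up to a null set form a proper
    filter, the members of [Phi w] being non-null. *)
Lemma finite_density_ultrafilters : P setT != 0 ->
  exists U, density_ultrafilters P U.
Proof.
move=> /density_base_measurable[Phi dP].
pose F w := [set S | exists2 G, Phi w G & P.-negligible (G `\` S)].
have FF w : ProperFilter (F w).
  split.
    move=> [G PG]; rewrite setD0 => /measure_negligible.
    by move=> /(_ (db_meas dP (db_sub dP PG))) G0; have := db_pos dP PG; rewrite G0 eqxx.
  split.
  - by exists setT; [exact: (dbT dP)|rewrite setDT; exact: negligible_set0].
  - move=> E E' [G PG GE] [G' PG' GE']; exists (G `&` G'); first exact: (dbI dP).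
    by rewrite setDIr; apply: negligibleU; [apply: negligibleS GE|apply: negligibleS GE'];
      move=> x /=; tauto.
  - move=> E E' EE' [G PG GE]; exists G => //; apply: negligibleS GE.
    exact: setDS.
have /choice[U UP] : forall w, exists G, UltraFilter G /\ F w `<=` G.
  by move=> w; exact: ultraFilterLemma.
exists U; split.
- by move=> w; have [] := UP w.
- move=> E aeE w; apply: (UP w).2; exists setT; first exact: (dbT dP).
  by rewrite setTD.
- move=> E mE; apply: filterS (db_ae dP mE) => w /[apply] PE.
  apply: (UP w).2; exists E => //.
  by rewrite setDv; exact: negligible_set0.
Qed.

End density_ultrafilter.

(** * Sigma-finite measures *)

Section sigma_finite.
Context {R : realType} {d : measure_display} {T : measurableType d}.
Variable mu : {measure set T -> \bar R}.
Hypothesis mu_sf : sigma_finite setT mu.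
Local Open Scope ereal_scope.

(** A weighted sum of the traces of [mu] on a covering by sets of finite measure.
    Density ultrafilters and essential suprema depend only on the null sets, so
    that [mu] may be replaced by a finite measure in their construction. *)
Lemma sigma_finite_equiv_finite : exists P : {finite_measure set T -> \bar R},
  forall E, measurable E -> (P E = 0 <-> mu E = 0).
Proof.
have [A AT mA] := mu_sf.
have mA' n : measurable (A n) by have [] := mA n.
have muA n : mu (A n) \is a fin_num by rewrite ge0_fin_numE//; have [] := mA n.
pose c n : R := (1 / (2 ^ n.+1)%:R / (1 + fine (mu (A n))))%R.
have f0 n : (0 < 1 + fine (mu (A n)))%R by rewrite ltr_pwDl// fine_ge0.
have c0 n : (0 < c n)%R by rewrite /c !divr_gt0// ltr0n expn_gt0.
pose m n : {measure set T -> \bar R} := mscale (NngNum (ltW (c0 n))) (mrestr mu (mA' n)).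
pose P := mseries m 0.
have mE n E : m n E = (c n)%:E * mu (E `&` A n) by [].
have PT : P setT <= 1.
  apply: (@le_trans _ _ (\sum_(0 <= i <oo) (1 / (2 ^ i.+1)%:R)%:E)); last first.
    exact: (@epsilon_trick0 R 1 xpredT).
  apply: lee_nneseries => // n _; rewrite mE setTI -[mu _]fineK// -EFinM lee_fin.
  rewrite /c mulrAC ler_pdivrMr// ler_wpM2l ?divr_ge0// lerDr//.
have Pfin : fin_num_fun P.
  move=> E mE'; rewrite ge0_fin_numE// (@le_lt_trans _ _ (P setT))//.
    by apply: le_measure; rewrite ?inE.
  by rewrite (le_lt_trans PT)// ltry.
pose PF := Measure_isFinite.Build _ _ _ P Pfin.
pose P' : {finite_measure set T -> \bar R} := HB.pack P PF.
exists P' => E mE'; split.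
- move=> PE0; have mn n : m n E = 0.
    apply/eqP; rewrite eq_le measure_ge0 andbT -PE0 /= /P /mseries.
    apply: le_trans (nneseries_lim_ge n.+1 _); last by [].
    by rewrite big_nat_recr//= leeDr// sume_ge0.
  have : mu.-negligible (\bigcup_n (E `&` A n)).
    apply: negligible_bigcup => n; apply/negligibleP; first exact: measurableI.
    have := mn n; rewrite mE => /eqP; rewrite mule_eq0 eqe gt_eqF//= => /eqP.
    exact.
  by rewrite -setI_bigcupr -AT setIT => /negligibleP; exact.
- move=> E0; apply: eseries0 => n _ _; rewrite mE.
  by rewrite (@subset_measure0 _ _ _ mu _ E) ?mule0//; exact: measurableI.
Qed.

Lemma sigma_finite_density_ultrafilters : mu setT != 0 ->
  exists U, density_ultrafilters mu U.
Proof.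
have [P PE] := sigma_finite_equiv_finite; move=> muT.
have aeE S : {ae mu, forall w, S w} <-> {ae P, forall w, S w}.
  by split => -[N [mN N0 SN]]; exists N; split => //; apply/PE.
have [|U [Uu Uae Ud]] := @finite_density_ultrafilters _ _ _ P.
  by apply: contra muT => /eqP/PE ->.
exists U; split => //; first by move=> E /aeE; exact: Uae.
by move=> E mE; apply/aeE; exact: Ud.
Qed.

(** The essential supremum of the family [k] is reached by a sequence: for each
    rational [q], countable unions of the sets where [q < k i] have an
    essentially largest element. *)
Lemma ess_sup_countable (I : Type) (i0 : I) (k : I -> T -> R) :
  (forall i, measurable_fun setT (k i)) ->
  exists s : nat -> I, forall i (q : rat),
    {ae mu, forall w, (ratr q < k i w)%R -> exists n, (ratr q < k (s n) w)%R}.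
Proof.
move=> mk; have [P PE] := sigma_finite_equiv_finite.
pose L i (q : rat) := [set w | (ratr q < k i w)%R].
have mL i q : measurable (L i q).
  rewrite /L (_ : [set _ | _] = setT `&` k i @^-1` `]ratr q, +oo[%classic); first exact: mk.
  by rewrite setTI; apply/seteqP; split => w; rewrite /= in_itv/= andbT.
have Zq (q : rat) : exists s : nat -> I, forall i, P (L i q `\` \bigcup_n L (s n) q) = 0.
  have [||F FZ|Z [s ->] Zmax] := @essentially_largest _ _ _ P
      [set E | exists s : nat -> I, E = \bigcup_n L (s n) q].
  - by move=> _ [s ->]; apply: bigcup_measurable => n _; exact: mL.
  - by exists (\bigcup_(n : nat) L i0 q), (fun=> i0).
  - move: FZ => /choice[s sE].
    pose s' n := let: nm := odflt (0%N, 0%N) (unpickle n) in s nm.1 nm.2.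
    exists s'; apply/seteqP; split => w.
      move=> [n _]; rewrite sE => -[m _ h]; exists (pickle (n, m)) => //.
      by rewrite /s' pickleK.
    move=> [n _ h]; rewrite /s' in h; move: (odflt _ _) h => -[a b] h.
    by exists a => //; rewrite sE; exists b.
  - exists s => i; apply: Zmax; exists (fun=> i).
    by apply/seteqP; split => w; [exists 0%N|case].
move: Zq => /choice[s sP].
pose s' n := let: nm := odflt (0%Q, 0%N) (unpickle n) in s nm.1 nm.2.
exists s' => i q; exists (L i q `\` \bigcup_n L (s q n) q); split.
- by apply: measurableD => //; apply: bigcup_measurable => n _; exact: mL.
- apply/PE => //.
  by apply: measurableD => //; apply: bigcup_measurable => n _; exact: mL.
- move=> w /= /not_implyP[h nex]; split => // -[n _ hn]; apply: nex.
  by exists (pickle (q, n)); rewrite /s' pickleK.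
Qed.

End sigma_finite.

(** * Limits along ultrafilters *)

Section ultrafilter_limits.
Context {R : realType}.

Lemma ultra_cvg_bounded (T : Type) (F : set_system T) (f : T -> R) (C : R) :
  UltraFilter F -> (forall x, `|f x| <= C) -> cvg (f x @[x --> F]).
Proof.
move=> UF fC.
have PF : ProperFilter F by exact: ultra_proper.
have [|p [_ cp]] := @segment_compact R (- C) C (f x @[x --> F]) _.
  by rewrite /fmap/= /nbhs/=; apply: filterE => x /=; rewrite in_itv/= -ler_norml.
apply/cvg_ex; exists p => V Vp.
have [//|FV] := in_ultra_setVsetC (f @^-1` V) UF.
by have [x [/= nVx Vx]] := cp (~` V) V FV Vp.
Qed.

Context {d : measure_display} {T : measurableType d}.
Variable mu : {measure set T -> \bar R}.

(** Almost every [w] is such that each rational interval containing [f w] has its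
    preimage in [U w]: there are countably many of them. *)
Lemma density_filter_cvg (U : T -> set_system T) (f : T -> R) :
  (forall w, ProperFilter (U w)) ->
  (forall E, measurable E -> {ae mu, forall w, E w -> U w E}) ->
  measurable_fun setT f -> {ae mu, forall w, f x @[x --> U w] --> f w}.
Proof.
move=> PU UE mf.
pose E (q : rat * rat) := f @^-1` `]ratr q.1, ratr q.2[%classic.
have mE q : measurable (E q) by rewrite -[E q]setTI; exact: mf.
have aeE : {ae mu, forall w n q, unpickle n = Some q -> E q w -> U w (E q)}.
  apply/ae_foralln => n; case: (unpickle n) => [q|]; last exact: nearW.
  by apply: filterS (UE _ (mE q)) => w Uw _ [<-].
apply: filterS aeE => w Uw; apply/cvgrPdist_lt => e e0.
have /rat_in_itvoo[a] : f w - e < f w by rewrite ltrBlDr ltrDl.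
have /rat_in_itvoo[b] : f w < f w + e by rewrite ltrDl.
rewrite !in_itv/= => /andP[fb be] /andP[ea af].
have := Uw (pickle (a, b)) (a, b); rewrite pickleK => /(_ erefl).
have Ew : E (a, b) w by rewrite /E/= in_itv/= af.
move=> /(_ Ew); apply: filterS => x; rewrite /E/= in_itv/= => /andP[ax xb].
rewrite ltr_distlC; apply/andP; split; [exact: lt_trans ax|exact: lt_trans be].
Qed.

End ultrafilter_limits.

(** * Norms of functionals through their real parts *)

Section dual_norm.
Context {R : realType}.
Local Open Scope complex_scope.

Lemma norm_phase (z : R[i]) : exists2 u : R[i], `|u| = 1 & u * z = `|z|.
Proof.
have [->|z0] := eqVneq z 0; first by exists 1; rewrite ?normr1// mulr0 normr0.
exists (`|z| / z); last by rewrite divfK.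
by rewrite normrM normrV ?unitfE// normr_id divff// normr_eq0.
Qed.

Lemma ReD (y z : R[i]) : complex.Re (y + z) = complex.Re y + complex.Re z.
Proof. by case: y z => a b [c e]. Qed.

Lemma Re_realM (a : R) (z : R[i]) : complex.Re (a%:C * z) = a * complex.Re z.
Proof. by case: z => b c /=; rewrite mul0r subr0. Qed.

Lemma Re_le_rnorm (z : R[i]^o) : `|complex.Re z| <= rnorm z.
Proof. by rewrite -lecR -rnormE; exact: normc_ge_Re. Qed.

Lemma rnorm_real (V : normedModType R[i]) (a : R) (x : V) :
  rnorm (a%:C *: x) = `|a| * rnorm x.
Proof. by rewrite rnormZ normc_def /= expr0n/= addr0 sqrtr_sqr. Qed.

Variable V : normedModType R[i].

Lemma rnorm_phase (f : dual V) (x : V) :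
  exists2 y, rnorm y = rnorm x & rnorm (f x) = complex.Re (f y).
Proof.
have [u u1 uz] := norm_phase (f x); exists (u *: x); first by rewrite rnormZ u1 mul1r.
by rewrite linearZ/= [u *: _]uz.
Qed.

Lemma dual_bounded (f : dual V) :
  exists2 M, 0 <= M & forall x, rnorm (f x) <= M * rnorm x.
Proof.
have /linear_boundedP[M [Mreal /(_ (M + 1))]] :=
  continuous_linear_bounded 0 (@dual_continuous _ _ f 0).
rewrite ltrDl ltr01 => /(_ isT) fM; exists `|complex.Re (M + 1)| => // x.
have := fM x; rewrite rnormE (rnormE x) lecE => /andP[_].
rewrite mulrC Re_realM mulrC => /le_trans; apply.
by apply: ler_wpM2r; [exact: rnorm_ge0|exact: ler_norm].
Qed.

Lemma le_dual_norm (f : dual V) (x : V) : rnorm (f x) <= dual_norm f * rnorm x.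
Proof.
have [M M0 fM] := dual_bounded f.
have [/rnorm_eq0 ->|x0] := eqVneq (rnorm x) 0.
  by rewrite linear0 !rnorm0 mulr0.
have xp : 0 < rnorm x by rewrite lt_neqAle eq_sym x0 rnorm_ge0.
rewrite -ler_pdivrMr//; apply: ub_le_sup.
  exists M => _ [y /= y1 <-]; apply: le_trans (fM y) _.
  by rewrite ler_piMr.
exists ((rnorm x)^-1%:C *: x).
  by rewrite /= rnorm_real ger0_norm ?invr_ge0 ?rnorm_ge0// mulVf.
rewrite linearZ/= (rnorm_real). 
by rewrite ger0_norm ?invr_ge0 ?rnorm_ge0// mulrC.
Qed.

Lemma dual_norm_ge0 (f : dual V) : 0 <= dual_norm f.
Proof.
have [M M0 fM] := dual_bounded f; apply: ub_le_sup.
  exists M => _ [y /= y1 <-]; apply: le_trans (fM y) _.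
  by rewrite ler_piMr.
by exists 0; rewrite /= ?linear0 rnorm0.
Qed.

Lemma dual_norm_le (f : dual V) (K : R) :
  (forall x, rnorm x <= 1 -> complex.Re (f x) <= K) -> dual_norm f <= K.
Proof.
move=> fK; apply: ge_sup.
  by exists 0, 0; rewrite /= ?rnorm0// linear0 rnorm0.
move=> _ [x /= x1 <-]; have [y yx ->] := rnorm_phase f x.
by apply: fK; rewrite yx.
Qed.

(** A functional is determined by its real part (Bohnenblust and Sobczyk); after
    multiplication of the vector by a phase, [|h x|] is a value of [l], so that
    [h] has the same bound as [l]. *)
Lemma dual_of_real (l : V -> R) (C : R) :
  (forall a x y, l (a%:C *: x + y) = a * l x + l y) ->
  (forall x, `|l x| <= C * rnorm x) ->
  exists g : dual V, forall x, g x = (l x +i* - l ('i%C *: x))%C.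
Proof.
move=> llin lC.
pose h (x : V) : R[i]^o := (l x +i* - l ('i%C *: x))%C.
have lD x y : l (x + y) = l x + l y by rewrite -[x]scale1r llin mul1r scale1r.
have lZ (a : R) x : l (a%:C *: x) = a * l x.
  have l0 : l 0 = 0 by apply: (addrI (l 0)); rewrite -lD !addr0.
  by rewrite -[a%:C *: x]addr0 llin l0 addr0.
have hlin : linear h.
  move=> [a b] x y.
  have E : (a +i* b)%C *: x = a%:C *: x + b%:C *: ('i%C *: x).
    rewrite scalerA -scalerDl; congr (_ *: _).
    by apply/eqP; rewrite eq_complex /=; apply/andP; split; apply/eqP; ring.
  have E' : 'i%C *: ((a +i* b)%C *: x) = a%:C *: ('i%C *: x) + (- b)%:C *: x.
    rewrite !scalerA -scalerDl; congr (_ *: _).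
    by apply/eqP; rewrite eq_complex /=; apply/andP; split; apply/eqP; ring.
  rewrite /h scalerDr E' E !lD !lZ.
  by apply/eqP; rewrite eq_complex /=; apply/andP; split; apply/eqP; ring.
pose hL : {linear V -> R[i]^o} := HB.pack h (GRing.isLinear.Build _ _ _ _ h hlin).
have hC : continuous hL.
  apply/linear_bounded_continuous/linear_boundedP.
  exists C%:C; split; first by rewrite complex_real.
  move=> r Cr x; apply: (@le_trans _ _ (C%:C * `|x|)); last first.
    by rewrite ler_wpM2r// ltW.
  rewrite rnormE [X in _ * X]rnormE -rmorphM lecR.
  have [u u1 uz] := norm_phase (h x).
  have -> : rnorm (hL x : R[i]^o) = complex.Re (h (u *: x)).
    have -> : h (u *: x) = u *: hL x by rewrite -linearZ.
    by rewrite [u *: _]uz.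
  apply: le_trans (ler_norm _) (le_trans (lC _) _).
  by rewrite rnormZ u1 mul1r.
by exists (Dual hC).
Qed.

End dual_norm.

(** * Radon-Nikodym densities of bounded set functions *)

Section integral_comparison.
Context {R : realType} {d : measure_display} {T : measurableType d}.
Variable mu : {measure set T -> \bar R}.

Lemma bounded_integrable (f : T -> R) (C : R) (E : set T) :
  measurable_fun setT f -> (forall w, `|f w| <= C) -> measurable E ->
  (mu E < +oo)%E -> mu.-integrable E (EFin \o f).
Proof.
move=> mf fC mE Efin; apply: measurable_bounded_integrable => //.
  exact: measurable_funTS.
by exists C; split; [exact: num_real|move=> M CM w _; exact: le_trans (fC w) (ltW CM)].
Qed.

(** Tested on the set where [g < f], the hypothesis makes the integral of [f - g]
    over it vanish. *)
Lemma ae_le_Rintegral (D : set T) (f g : T -> R) : measurable D ->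
  mu.-integrable D (EFin \o f) -> mu.-integrable D (EFin \o g) ->
  (forall E, measurable E -> E `<=` D ->
     \int[mu]_(w in E) f w <= \int[mu]_(w in E) g w) ->
  {ae mu, forall w, D w -> f w <= g w}.
Proof.
move=> mD intf intg fg.
have mf := measurable_int mu intf; have mg := measurable_int mu intg.
pose E := D `&` [set w | (EFin \o g) w < (EFin \o f) w]%E.
have mE : measurable E by exact: emeasurable_fun_lt.
have ED : E `<=` D by move=> ? [].
have intfE := integrableS mD mE ED intf.
have intgE := integrableS mD mE ED intg.
pose h w := f w - g w.
have intE : mu.-integrable E (EFin \o h).
  by have := integrableB mE intfE intgE; apply: eq_integrable.
have h0 : (\int[mu]_(w in E) `|(EFin \o h) w|)%E = 0%E.
  under eq_integral => w.
    rewrite inE => -[_]; rewrite /= lte_fin => gf.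
    rewrite ger0_norm; last by rewrite subr_ge0 ltW.
    over.
  have : \int[mu]_(w in E) h w <= 0.
    by rewrite RintegralB// subr_le0; exact: fg.
  rewrite /Rintegral => le0.
  have fin := integrable_fin_num mE intE.
  apply/eqP; rewrite eq_le; apply/andP; split.
    by rewrite -[X in (X <= _)%E]fineK// lee_fin.
  apply: integral_ge0 => w [_]; rewrite /= lte_fin => gf.
  by rewrite lee_fin subr_ge0 ltW.
have /(ae_eq_integral_abs mu mE) : measurable_fun E (EFin \o h).
  exact: measurable_int intE.
move=> /iffLR/(_ h0); apply: filterS => w /= Ew Dw; rewrite leNgt; apply/negP => gf.
have /Ew[] : E w by split => //=; rewrite lte_fin.
by move=> /eqP; rewrite subr_eq0 gt_eqF.
Qed.

End integral_comparison.

Section sigma_finite_instance.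
Context {R : realType} {d : measure_display} {T : measurableType d}.
Variable mu : {measure set T -> \bar R}.
Hypothesis mu_sf : sigma_finite setT mu.

(** An alias of [mu] whose type depends on the proof of sigma-finiteness, so that
    it can carry the structure required by the Radon-Nikodym theorem. *)
Definition sf_measure of sigma_finite setT mu : set T -> \bar R := mu.
HB.instance Definition _ := Measure.copy (sf_measure mu_sf) mu.
HB.instance Definition _ := Measure_isSigmaFinite.Build _ _ _ (sf_measure mu_sf) mu_sf.

End sigma_finite_instance.

Section bounded_set_function.
Context {R : realType} {d : measure_display} {T : measurableType d}.
Variable mu : {measure set T -> \bar R}.

(** Only the sets of finite measure matter: [Re phi(1_E x)] is meaningless for
    the others. *)
Definition bounded_additive (nu : set T -> R) (C : R) :=
  (forall E F, measurable E -> measurable F -> (mu E < +oo)%E -> (mu F < +oo)%E ->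
    E `&` F = set0 -> nu (E `|` F) = nu E + nu F) /\
  (forall E, measurable E -> (mu E < +oo)%E -> `|nu E| <= C * fine (mu E)).

(** Sigma-additivity: the remainders are controlled by [C] times their
    measure, which tends to 0. *)
Lemma bounded_additive_cvg (nu : set T -> R) (C : R) (G : nat -> set T) :
  bounded_additive nu C -> (forall n, measurable (G n)) ->
  {homo G : n m / (n <= m)%N >-> n `<=` m} -> (mu (\bigcup_n G n) < +oo)%E ->
  nu (G n) @[n --> \oo] --> nu (\bigcup_n G n).
Proof.
move=> [nuU nuC] mG Gh Gfin; set E := \bigcup_n G n in Gfin *.
have mE : measurable E by exact: bigcup_measurable.
have GE n : G n `<=` E by exact: bigcup_sup.
have fin F : measurable F -> F `<=` E -> (mu F < +oo)%E.
  by move=> mF FE; apply: le_lt_trans Gfin; apply: le_measure; rewrite ?inE.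
have mD n : measurable (E `\` G n) by exact: measurableD.
have nuD n : nu E - nu (G n) = nu (E `\` G n).
  rewrite -[in nu E](setDUK (GE n)) nuU//; last 3 first.
  - exact: fin.
  - by apply: fin => // ? [].
  - by rewrite setDE setICA setICr setI0.
  by rewrite addrC addKr.
have : (mu \o (fun n => E `\` G n)) n @[n --> \oo] --> mu (\bigcap_n (E `\` G n)).
  apply: nonincreasing_cvg_mu => //.
  - by apply: fin => // ? [].
  - exact: bigcap_measurable.
  - by move=> n m nm; apply/subsetPset; apply: setDS; exact: Gh.
have -> : \bigcap_n (E `\` G n) = set0.
  by apply/seteqP; split => // x h; have [[n _ Gnx] _] := h 0%N I; have [_] := h n I.
rewrite measure0 => /fine_cvgP[_] /= mu0.
have Cmu0 : C * fine (mu (E `\` G n)) @[n --> \oo] --> (0 : R).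
  by rewrite -(mulr0 C); apply: cvgMr.
apply/cvgrPdist_le => e e0; move/cvgrPdist_le : Cmu0 => /(_ e e0); apply: filterS => n.
rewrite sub0r normrN nuD => /(le_trans _); apply.
apply: le_trans (nuC _ (mD n) _) (ler_norm _).
by apply: fin => // ? [].
Qed.

Hypothesis mu_sf : sigma_finite setT mu.

(** On [A] the set function is a charge dominated by [mu].  Its density lies
    between [- C] and [C] almost everywhere on [A], and is truncated so that the
    bound holds everywhere. *)
Lemma bounded_additive_density_in (nu : set T -> R) (C : R) (A : set T) :
  0 <= C -> bounded_additive nu C -> measurable A -> (mu A < +oo)%E ->
  exists k : T -> R, [/\ measurable_fun setT k, forall w, `|k w| <= C &
    forall E, measurable E -> E `<=` A -> nu E = \int[mu]_(w in E) k w].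
Proof.
move=> C0 banu mA Afin; have [nuU nuC] := banu.
have finA E : measurable E -> (mu (E `&` A) < +oo)%E.
  by move=> mE; apply: le_lt_trans Afin; apply: measureIr.
pose nuA E : \bar R := (nu (E `&` A))%:E.
have nu_null E : measurable E -> mu E = 0%E -> nu E = 0.
  move=> mE E0; have := nuC E mE; rewrite E0 /= mulr0 normr_le0.
  by move=> /(_ (ltry 0))/eqP.
have nu0 : nuA set0 = 0%E by rewrite /nuA set0I nu_null// measure0.
have nufin E : measurable E -> nuA E \is a fin_num by [].
have nusig : semi_sigma_additive nuA.
  move=> F mF tF mUF.
  pose G n := \big[setU/set0]_(i < n) F i `&` A.
  have mG n : measurable (G n) by apply: measurableI => //; exact: bigsetU_measurable.
  have UG : \bigcup_n G n = \bigcup_n F n `&` A.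
    rewrite -setI_bigcupl; congr (_ `&` _).
    apply/seteqP; split => w; first by move=> [n _]; exact: bigsetU_bigcup.
    by move=> [n _ Fn]; exists n.+1 => //; rewrite -bigcup_mkord; exists n => /=.
  have Gh : {homo G : n m / (n <= m)%N >-> n `<=` m}.
    move=> n m nm; apply: setSI; rewrite -!bigcup_mkord => w [j /= jn Fj].
    by exists j => //=; exact: leq_trans jn nm.
  have := bounded_additive_cvg banu mG Gh; rewrite UG => /(_ (finA _ mUF)) cG.
  have -> : (fun n => \sum_(0 <= i < n) nuA (F i))%E = (fun n => (nu (G n))%:E).
    apply/funext; elim => [|n IH].
      by rewrite big_geq// /G big_ord0 set0I nu_null// measure0.
    rewrite big_nat_recr//= IH /nuA -EFinD; congr (_%:E).
    rewrite /G big_ord_recr/= setIUl; apply/esym/nuU.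
    - exact: mG.
    - exact: measurableI.
    - by apply: finA; exact: bigsetU_measurable.
    - exact: finA.
    - rewrite setIACA -bigcup_mkord setI_bigcupl bigcup0 ?set0I// => j /= jn.
      by apply: (trivIsetP.1 tF) => //; rewrite lt_eqF.
  by apply: cvg_EFin; first exact: nearW.
pose nuM := isCharge.Build _ _ _ nuA nu0 nufin nusig.
pose nu' : {charge set T -> \bar R} := HB.pack nuA nuM.
pose mu' : {sigma_finite_measure set T -> \bar R} := sf_measure mu_sf.
have dom : nu' `<< mu'.
  apply/null_content_dominatesP => E mE E0; congr (_%:E); apply: nu_null.
    exact: measurableI.
  by apply: subset_measure0 E0 => //; exact: measurableI.
pose f := Radon_Nikodym nu' mu'; pose g w := fine (f w).
have fg : f = EFin \o g.
  by apply/funext => w; rewrite /= fineK// /f Radon_Nikodym_fin_num.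
have intg : mu.-integrable setT (EFin \o g).
  by rewrite -fg; exact: Radon_Nikodym_integrable dom.
have nug E : measurable E -> E `<=` A -> nu E = \int[mu]_(w in E) g w.
  move=> mE EA; have := Radon_Nikodym_integral dom mE.
  rewrite -/f fg /= /nuA (setIidl EA) /Rintegral => e.
  by rewrite [LHS](_ : _ = fine (nu E)%:E)// e.
have intgA : mu.-integrable A (EFin \o g) by exact: integrableS intg.
have intc r : mu.-integrable A (EFin \o cst r).
  by apply: (@bounded_integrable _ _ _ _ _ `|r|).
have finE E : measurable E -> E `<=` A -> (mu E < +oo)%E.
  by move=> mE /setIidl <-; exact: finA.
have gC : {ae mu, forall w, A w -> g w <= C}.
  apply: ae_le_Rintegral (intgA) (intc C) _ => // E mE EA.
  rewrite -nug// Rintegral_cst//.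
  by apply: le_trans (ler_norm _) (nuC _ mE _); exact: finE.
have Cg : {ae mu, forall w, A w -> - C <= g w}.
  apply: ae_le_Rintegral (intc (- C)) intgA _ => // E mE EA.
  rewrite -nug// Rintegral_cst// mulNr.
  rewrite lerNl; apply: le_trans (ler_norm _) _; rewrite normrN.
  by apply: nuC => //; exact: finE.
have mg : measurable_fun setT g by apply/measurable_EFinP; exact: measurable_int intg.
have mk : measurable_fun setT (fun w => Num.max (- C) (Num.min C (g w))).
  by apply: measurable_maxr => //; exact: measurable_minr.
exists (fun w => Num.max (- C) (Num.min C (g w))); split => //.
- move=> w; rewrite ler_norml le_max lexx/= ge_max ge_min lexx/= andbT.
  by rewrite (le_trans _ C0)// oppr_le0.
- move=> E mE EA; rewrite nug//; congr fine; apply: ae_eq_integral => //.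
  + by apply/measurable_EFinP; exact: measurable_funTS.
  + by apply/measurable_EFinP; exact: measurable_funTS.
  + apply: filterS2 gC Cg => w gC Cg /EA Aw /=.
    by rewrite (min_idPr (gC Aw)) (max_idPr (Cg Aw)).
Qed.

(** The densities on the pieces of a partition into sets of finite measure are
    glued.  The difference between [nu] and the integral of the glued function
    is again bounded and additive, and vanishes on finite unions of pieces. *)
Lemma bounded_additive_density (nu : set T -> R) (C : R) :
  0 <= C -> bounded_additive nu C ->
  exists k : T -> R, [/\ measurable_fun setT k, forall w, `|k w| <= C &
    forall E, measurable E -> (mu E < +oo)%E -> nu E = \int[mu]_(w in E) k w].
Proof.
move=> C0 banu.
have [F FT mF] := mu_sf.
pose A := seqDU F.
have mA n : measurable (A n) by apply: seqDU_measurable => k; have [] := mF k.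
have Afin n : (mu (A n) < +oo)%E.
  apply: le_lt_trans (mF n).2; apply: le_measure; rewrite ?inE//; first exact: (mF n).1.
  exact: subset_seqDU.
have tA := trivIset_seqDU F; rewrite -/A in tA.
have AT w : exists n, A n w.
  have : (\bigcup_n A n) w by rewrite -seqDU_bigcup_eq -FT.
  by case=> n; exists n.
have /choice[k kP] n := bounded_additive_density_in C0 banu (mA n) (Afin n).
move: AT => /choice[i Ai].
have iE n w : A n w -> i w = n.
  move=> An; have [//|ne] := eqVneq (i w) n.
  have /trivIsetP/(_ _ _ I I ne) e := tA.
  by exfalso; have : (A (i w) `&` A n) w by []; rewrite e.
pose h w := k (i w) w.
have mh : measurable_fun setT h.
  move=> _ B mB; rewrite setTI.
  have -> : h @^-1` B = \bigcup_n (A n `&` k n @^-1` B).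
    apply/seteqP; split => w; first by exists (i w).
    by move=> [n _ [/iE <-]].
  apply: bigcup_measurable => n _; apply: measurableI => //.
  by rewrite -[X in measurable X]setTI; have [mk _ _] := kP n; exact: mk.
have hC w : `|h w| <= C by have [_ + _] := kP (i w); exact.
exists h; split => // E mE Efin.
have inth G : measurable G -> (mu G < +oo)%E -> mu.-integrable G (EFin \o h).
  exact: bounded_integrable mh hC.
have finI G H : measurable G -> measurable H -> (mu G < +oo)%E -> (mu (G `&` H) < +oo)%E.
  by move=> mG mH; apply: le_lt_trans; apply: measureIl.
pose del G := nu G - \int[mu]_(w in G) h w.
have badel : bounded_additive del (C + C).
  split.
    move=> G H mG mH Gfin Hfin GH0; rewrite /del banu.1// Rintegral_setU//.
    - by rewrite opprD addrACA.
    - apply: inth; first exact: measurableU.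
      by apply: le_lt_trans (measureU2 _ mG mH) _; exact: lte_add_pinfty.
    - by apply/eqP.
  move=> G mG Gfin; rewrite mulrDl; apply: le_trans (ler_normB _ _) _.
  apply: lerD; first exact: banu.2.
  apply: le_trans (le_normr_Rintegral mG (inth _ mG Gfin)) _.
  rewrite -Rintegral_cst//; apply: le_Rintegral => //.
  - exact: integrable_norm (inth _ mG Gfin).
  - by apply: (@bounded_integrable _ _ _ _ _ `|C|).
pose G n := E `&` \big[setU/set0]_(j < n) A j.
have mG n : measurable (G n) by apply: measurableI => //; exact: bigsetU_measurable.
have UG : \bigcup_n G n = E.
  rewrite -setI_bigcupr; apply/setIidl => w _.
  by exists (i w).+1 => //; rewrite -bigcup_mkord; exists (i w) => /=.
have delG n : del (G n) = 0.
  elim: n => [|n IH].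
    have := badel.2 set0 measurable0; rewrite measure0 /= mulr0 normr_le0.
    by rewrite /G big_ord0 setI0 => /(_ (ltry 0))/eqP.
  have -> : G n.+1 = G n `|` (E `&` A n) by rewrite /G big_ord_recr/= setIUr.
  have mEA : measurable (E `&` A n) by exact: measurableI.
  rewrite badel.1//; last 3 first.
  - by apply: finI => //; exact: bigsetU_measurable.
  - exact: finI.
  - rewrite /G setIACA -bigcup_mkord setI_bigcupl bigcup0 ?setI0// => j /= jn.
    by apply: (trivIsetP.1 tA) => //; rewrite lt_eqF.
  rewrite IH add0r /del; apply/eqP; rewrite subr_eq0; apply/eqP.
  have [_ _ ->] := kP n; [|by []|by move=> ? []].
  by apply: eq_Rintegral => w; rewrite inE => -[_ /iE]; rewrite /h => ->.
have Gh : {homo G : n m / (n <= m)%N >-> n `<=` m}.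
  move=> n m nm; apply: setIS; rewrite -!bigcup_mkord => w [j /= jn Aj].
  by exists j => //=; exact: leq_trans jn nm.
have := bounded_additive_cvg badel mG Gh; rewrite UG => /(_ Efin).
under eq_fun do rewrite delG.
move=> /(cvg_lim (@Rhausdorff R)); rewrite lim_cst// => /esym/eqP.
by rewrite subr_eq0 => /eqP.
Qed.

End bounded_set_function.

(** * The real part of a functional on the Bochner space *)

Section real_part_functional.
Context {R : realType} {X : normedModType R[i]}.
Context {d : measure_display} {T : measurableType d}.
Variable mu : {measure set T -> \bar R}.
Variable phi : dual (L1 mu X).
Local Open Scope complex_scope.

Lemma integrable_simple_bochner (s : T -> X) :
  integrable_simple mu s -> bochner_integrable mu s.
Proof.
move=> ss; split; first exact: strongly_measurable_simple ss.1.
exists (fun=> s); split => //.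
rewrite integral0_eq; first exact: cvg_cst.
by move=> w _; rewrite subrr rnorm0.
Qed.

Definition to_bochner (f : T -> X) (bf : bochner_integrable mu f) : bochner mu X :=
  @Bochner _ _ _ mu X f (asboolT bf).

(** The value of [Re phi] on a plain function, 0 if it is not integrable; this
    avoids carrying proofs of integrability in the computations. *)
Definition Re_functional (f : T -> X) : R :=
  if pselect (bochner_integrable mu f) is left bf
  then complex.Re (phi (L1class (to_bochner bf))) else 0.

Lemma Re_functionalE (f : bochner mu X) :
  Re_functional f = complex.Re (phi (L1class f)).
Proof.
rewrite /Re_functional; case: pselect => [bf|[]]; last exact: bochnerP.
by congr (complex.Re (phi (L1class _))); exact: val_inj.
Qed.

Lemma Re_functional_linear (a : R) (f g : T -> X) :
  bochner_integrable mu f -> bochner_integrable mu g ->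
  Re_functional (a%:C *: f + g) = a * Re_functional f + Re_functional g.
Proof.
move=> bf bg; pose F := to_bochner bf; pose G := to_bochner bg.
rewrite -[a%:C *: f + g]/(bochner_fun (a%:C *: F + G)).
rewrite -[f in RHS]/(bochner_fun F) -[g in RHS]/(bochner_fun G) !Re_functionalE.
by rewrite L1classD L1classZ linearP ReD -Re_realM.
Qed.

Lemma Re_functional_le (f : T -> X) : bochner_integrable mu f ->
  `|Re_functional f| <= dual_norm phi * fine (int_norm mu f).
Proof.
move=> bf; pose F := to_bochner bf.
rewrite -[f in leLHS]/(bochner_fun F) Re_functionalE.
apply: le_trans (Re_le_rnorm _) _.
by apply: le_trans (le_dual_norm _ _) _; rewrite L1_normE.
Qed.

Definition indic_vec (E : set T) (x : X) (w : T) : X := if w \in E then x else 0.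

Lemma indic_vec_simple E x : measurable E -> simple (indic_vec E x).
Proof.
move=> mE; split.
  apply: (@sub_finite_set _ _ [set x; 0]); last by rewrite finite_setU.
  by move=> _ [w _ <-]; rewrite /indic_vec; case: ifP => _; [left|right].
move=> y; have [|] := pselect (x = y); have [|] := pselect (0 = y :> X) => y0 xy.
- rewrite (_ : _ @^-1` _ = setT)//; apply/seteqP; split => // w _.
  by rewrite /indic_vec /=; case: ifP.
- rewrite (_ : _ @^-1` _ = E)//; apply/seteqP; split => w; rewrite /indic_vec /=.
    by case: ifPn => [/set_mem|].
  by move=> /mem_set ->.
- rewrite (_ : _ @^-1` _ = ~` E); first exact: measurableC.
  apply/seteqP; split => w; rewrite /indic_vec /=.
    by case: ifPn => // /negP nE _ Ew; apply: nE; exact/mem_set.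
  by move=> nE; rewrite memNset.
- rewrite (_ : _ @^-1` _ = set0)//; apply/seteqP; split => // w.
  by rewrite /indic_vec /=; case: ifP.
Qed.

Lemma indic_vec_integrable E x : measurable E -> (mu E < +oo)%E ->
  bochner_integrable mu (indic_vec E x).
Proof.
move=> mE Efin; apply: integrable_simple_bochner; split; first exact: indic_vec_simple.
apply: le_lt_trans Efin; apply: le_measure; rewrite ?inE//.
  exact: (simple_preimage [set y | y <> 0] (indic_vec_simple x mE)).
by move=> w /=; rewrite /indic_vec; case: ifPn => [/set_mem|].
Qed.

Lemma int_norm_indic_vec E x : measurable E ->
  int_norm mu (indic_vec E x) = ((rnorm x)%:E * mu E)%E.
Proof.
move=> mE; rewrite /int_norm -(setIT E) -integral_indic// -ge0_integralZl//; last 2 first.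
- by apply/measurable_EFinP; exact: measurable_indic.
- by rewrite lee_fin rnorm_ge0.
apply: eq_integral => w _; rewrite setIT /indic_vec indicE; case: ifP => _.
  by rewrite mule1.
by rewrite mule0 rnorm0.
Qed.

Lemma Re_functional_indic_bounded x :
  bounded_additive mu (fun E => Re_functional (indic_vec E x))
    (dual_norm phi * rnorm x).
Proof.
split => [E F mE mF Efin Ffin EF0|E mE Efin].
  rewrite -[X in _ = X + _]mul1r -Re_functional_linear; [|exact: indic_vec_integrable..].
  congr Re_functional; apply/funext => w; rewrite !fctE scale1r /indic_vec in_setU.
  have : ~ (E `&` F) w by rewrite EF0.
  case: (boolP (w \in E)) => [/set_mem Ew|_]; last by rewrite add0r.
  case: (boolP (w \in F)) => [/set_mem Fw|_] //=; last by rewrite addr0.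
  by case.
apply: le_trans (Re_functional_le (indic_vec_integrable x mE Efin)) _.
by rewrite int_norm_indic_vec// -mulrA fineM// ge0_fin_numE.
Qed.

End real_part_functional.

(** * Measurability for the completion *)

Section ae_measurable.
Context {R : realType} {d : measure_display} {T : measurableType d}.
Variable mu : {measure set T -> \bar R}.

Definition ae_measurable (h : T -> R) :=
  exists2 f, measurable_fun setT f & {ae mu, forall w, h w = f w}.

Lemma completed_ae (A B : set T) : measurable B ->
  {ae mu, forall w, A w <-> B w} -> completed_algebra_gen mu A.
Proof.
move=> mB [N [mN N0 AB]]; exists (B `\` N); first exact: measurableD.
exists (A `&` N); first by exists N; split => // w [].
have ABw w : ~ N w -> (A w <-> B w) by move=> nN; apply: contrapT => /AB.
apply/seteqP; split => w.
  by case=> [[Bw nN]|[]//]; apply/ABw.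
move=> Aw; have [Nw|nN] := pselect (N w); first by right.
by left; split => //; apply/ABw.
Qed.

Lemma ae_measurable_mu_measurable (h : T -> R) : ae_measurable h -> mu_measurable mu h.
Proof.
move=> [f mf hf] U oU; apply: (@completed_ae _ (f @^-1` U)).
  by rewrite -[X in measurable X]setTI; apply: mf => //; exact: open_measurable.
by apply: filterS hf => w /= ->.
Qed.

Lemma rnorm_le_Re_Im (z : R[i]^o) : rnorm z <= `|complex.Re z| + `|complex.Im z|.
Proof.
rewrite -lecR -rnormE [z in leLHS](complexE z) rmorphD /=.
apply: le_trans (ler_normD _ _) _; apply: lerD.
  by rewrite normc_def /= expr0n/= addr0 sqrtr_sqr.
by rewrite normrM !normc_def /= !expr0n/= addr0 add0r expr1n sqrtr1 mul1r sqrtr_sqr.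
Qed.

(** An open set of complex numbers is a countable union of open squares with
    rational centers, so the real and imaginary parts decide. *)
Lemma mu_measurable_complex (h : T -> R[i]^o) :
  ae_measurable (fun w => complex.Re (h w)) ->
  ae_measurable (fun w => complex.Im (h w)) -> mu_measurable mu h.
Proof.
move=> [f mf hf] [g mg hg] U oU.
pose box (q : rat * rat * nat) : set R[i]^o := [set z |
  `|complex.Re z - ratr q.1.1| < q.2.+1%:R^-1 /\
  `|complex.Im z - ratr q.1.2| < q.2.+1%:R^-1].
pose fg w : R[i]^o := (f w +i* g w)%C.
pose F q := [set w | box q `<=` U /\ box q (fg w)].
have UE : fg @^-1` U = \bigcup_q F q.
  apply/seteqP; split => w; last by move=> [q _ [qU /qU]].
  move=> /= Uw; have : nbhs (fg w) U by exact: open_nbhs_nbhs.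
  move=> /nbhs_ballP[e /= e0 eU].
  have e0' : 0 < complex.Re e by move: e0; rewrite ltcE => /andP[_].
  have eE : e = (complex.Re e)%:C%C.
    by move: e0; case: (e) => a b; rewrite ltcE/= => /andP[/eqP -> _].
  have [n] : exists n : nat, 0 + n.+1%:R^-1 < complex.Re e / 4.
    by apply: ltr_add_invr; rewrite divr_gt0.
  rewrite add0r => ne; have n0 : 0 < n.+1%:R^-1 :> R by rewrite invr_gt0.
  have near (a : R) : exists q : rat, `|a - ratr q| < n.+1%:R^-1.
    have /rat_in_itvoo[q] : a - n.+1%:R^-1 < a + n.+1%:R^-1.
      by rewrite ltrD2l gtrN.
    rewrite in_itv/= => /andP[aq qa]; exists q.
    by rewrite distrC ltr_distl aq qa.
  have [q1 fq] := near (f w); have [q2 gq] := near (g w).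
  exists (q1, q2, n) => //; split => //= z [/= zq1 zq2]; apply: eU.
  rewrite -ball_normE /= rnormE eE ltcR.
  apply: le_lt_trans (rnorm_le_Re_Im _) _.
  have -> : complex.Re (fg w - z) = f w - complex.Re z by case: (z).
  have -> : complex.Im (fg w - z) = g w - complex.Im z by case: (z).
  have h1 := ler_distD (ratr q1) (f w) (complex.Re z).
  have h2 := ler_distD (ratr q2) (g w) (complex.Im z).
  rewrite (distrC (ratr q1)) in h1; rewrite (distrC (ratr q2)) in h2.
  by move: ne fq gq zq1 zq2; move: (n.+1%:R^-1 : R) => dl; lra.
apply: (@completed_ae _ (fg @^-1` U)); last first.
  apply: filterS2 hf hg => w fw gw /=; rewrite /fg -fw -gw.
  by case: (h w).
rewrite UE; apply: countable_bigcupT_measurable; first exact: countableP.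
move=> q; have [qU|nqU] := pselect (box q `<=` U); last first.
  by rewrite (_ : F q = set0)//; apply/seteqP; split => // w [].
have mlt (k : T -> R) r : measurable_fun setT k ->
    measurable [set w | `|k w - r| < q.2.+1%:R^-1].
  move=> mk; rewrite (_ : [set _ | _] =
      setT `&` k @^-1` `]r - q.2.+1%:R^-1, r + q.2.+1%:R^-1[%classic).
    exact: mk.
  by rewrite setTI; apply/seteqP; split => w; rewrite /= in_itv/= ltr_distl.
rewrite (_ : F q = [set w | `|f w - ratr q.1.1| < q.2.+1%:R^-1] `&`
    [set w | `|g w - ratr q.1.2| < q.2.+1%:R^-1]).
  by apply: measurableI; exact: mlt.
by apply/seteqP; split => w; [case=> _ []|case].
Qed.

Lemma ae_measurable_lim (h : nat -> T -> R) (l : T -> R) :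
  (forall n, ae_measurable (h n)) ->
  {ae mu, forall w, h n w @[n --> \oo] --> l w} -> ae_measurable l.
Proof.
move=> /(_ _)/cid2-/all_sig2[f mf hf] hl.
have [N [mN N0 NP]] := filterI (ae_foralln hf) hl.
have NP' w : ~ N w -> (forall n, h n w = f n w) /\ h n w @[n --> \oo] --> l w.
  by move=> nN; apply: contrapT => /NP.
exists (fun w => l w * \1_(~` N) w).
  apply: (measurable_fun_cvg (h := fun n w => f n w * \1_(~` N) w)).
    move=> n; apply: measurable_funM => //.
    by apply: measurable_indic; exact: measurableC.
  move=> w _; rewrite indicE; case: (boolP (w \in _)) => [/set_mem nN|_].
    rewrite mulr1; under eq_fun do rewrite mulr1.
    have [hfw] := NP' w nN; apply: cvg_trans.
    by under eq_fun do rewrite -hfw.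
  by rewrite mulr0; under eq_fun do rewrite mulr0; exact: cvg_cst.
exists N; split => // w /=; apply: contra_notP => nN.
by rewrite indicE mem_set ?mulr1.
Qed.

Lemma ae_eq_Rintegral (f g : T -> R) : {ae mu, forall w, f w = g w} ->
  Rintegral mu setT f = Rintegral mu setT g.
Proof.
by move=> fg; congr fine; apply: ae_integral_eq; apply: filterS fg => w ->.
Qed.

Hypothesis mu_sf : sigma_finite setT mu.

(** By sigma-finiteness the densities need only be compared on sets of finite
    measure, where they are integrable. *)
Lemma ae_eq_density (f g : T -> R) (C : R) :
  measurable_fun setT f -> measurable_fun setT g ->
  (forall w, `|f w| <= C) -> (forall w, `|g w| <= C) ->
  (forall E, measurable E -> (mu E < +oo)%E ->
    \int[mu]_(w in E) f w = \int[mu]_(w in E) g w) ->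
  {ae mu, forall w, f w = g w}.
Proof.
move=> mf mg fC gC fg; have [F FT mF] := mu_sf.
have fgF n : {ae mu, forall w, F n w -> f w = g w}.
  have [mFn Ffin] := mF n.
  have intf := bounded_integrable mf fC mFn Ffin.
  have intg := bounded_integrable mg gC mFn Ffin.
  have fin E : measurable E -> E `<=` F n -> (mu E < +oo)%E.
    by move=> mE EF; apply: le_lt_trans Ffin; apply: le_measure; rewrite ?inE.
  have fleg : {ae mu, forall w, F n w -> f w <= g w}.
    by apply: ae_le_Rintegral => // E mE EF; rewrite fg//; exact: fin.
  have glef : {ae mu, forall w, F n w -> g w <= f w}.
    by apply: ae_le_Rintegral => // E mE EF; rewrite fg//; exact: fin.
  apply: filterS2 fleg glef => w fg' gf' Fw.
  by apply/eqP; rewrite eq_le fg'// gf'.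
apply: filterS (ae_foralln fgF) => w fgw.
have [n _ Fw] : (\bigcup_n F n) w by rewrite -FT.
exact: fgw Fw.
Qed.

End ae_measurable.

(** * The representing function *)

Section representation.
Context {R : realType} {X : normedModType R[i]}.
Context {d : measure_display} {T : measurableType d}.
Variable mu : {measure set T -> \bar R}.
Hypothesis mu_sf : sigma_finite setT mu.
Variable phi : dual (L1 mu X).
Local Open Scope complex_scope.
Local Notation C := (dual_norm phi).
Local Notation Phi := (Re_functional phi).

Definition scalar_density (k : X -> T -> R) := forall x,
  [/\ measurable_fun setT (k x), forall w, `|k x w| <= C * rnorm x &
   forall E, measurable E -> (mu E < +oo)%E ->
     Phi (indic_vec E x) = \int[mu]_(w in E) k x w].

Lemma scalar_density_exists : exists k, scalar_density k.
Proof.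
suff /choice[k kP] : forall x, exists k : T -> R,
    [/\ measurable_fun setT k, forall w, `|k w| <= C * rnorm x &
     forall E, measurable E -> (mu E < +oo)%E ->
       Phi (indic_vec E x) = \int[mu]_(w in E) k w] by exists k.
move=> x; apply: bounded_additive_density => //.
  by rewrite mulr_ge0 ?rnorm_ge0 ?dual_norm_ge0.
exact: Re_functional_indic_bounded.
Qed.

Variable k : X -> T -> R.
Hypothesis kP : scalar_density k.

Let mk x : measurable_fun setT (k x).
Proof. by have [] := kP x. Qed.

Let kC x w : `|k x w| <= C * rnorm x.
Proof. by have [_ + _] := kP x; exact. Qed.

Let kE x E : measurable E -> (mu E < +oo)%E ->
  Phi (indic_vec E x) = \int[mu]_(w in E) k x w.
Proof. by have [_ _ +] := kP x; exact. Qed.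

Lemma k_integrable x E : measurable E -> (mu E < +oo)%E ->
  mu.-integrable E (EFin \o k x).
Proof. by apply: bounded_integrable => //; exact: kC. Qed.

(** Both sides are densities of the same set function. *)
Lemma k_linear a x y :
  {ae mu, forall w, k (a%:C *: x + y) w = a * k x w + k y w}.
Proof.
pose M := C * rnorm (a%:C *: x + y) + (`|a| * (C * rnorm x) + C * rnorm y).
have C0 := dual_norm_ge0 phi.
have M0 z : 0 <= C * rnorm z by rewrite mulr_ge0 ?rnorm_ge0.
apply: (@ae_eq_density _ _ _ _ mu_sf _ _ M) => //.
- by apply: measurable_funD => //; exact: measurable_funM.
- by move=> w; apply: le_trans (kC _ _) _; rewrite lerDl addr_ge0// mulr_ge0.
- move=> w; apply: le_trans (ler_normD _ _) _; rewrite normrM.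
  apply: ler_wpDl => //; apply: lerD => //.
  by apply: ler_wpM2l.
move=> E mE Efin; rewrite -kE//.
have akx : mu.-integrable E (EFin \o (fun w => a * k x w)).
  by have := integrableZl mE a (k_integrable x mE Efin); apply: eq_integrable.
rewrite RintegralD//; last exact: k_integrable.
rewrite RintegralZl//; last exact: k_integrable.
rewrite -!kE// -Re_functional_linear; [|exact: indic_vec_integrable..].
congr Re_functional; apply/funext => w; rewrite !fctE /indic_vec.
by case: ifP => // _; rewrite scaler0 addr0.
Qed.

Variable U : T -> set_system T.
Hypothesis UP : density_ultrafilters mu U.

Let Uultra w : UltraFilter (U w).
Proof. by case: UP. Qed.

Let Uae (E : set T) : {ae mu, forall w, E w} -> forall w, U w E.
Proof. by case: UP => _ + _; exact. Qed.

Let Ud E : measurable E -> {ae mu, forall w, E w -> U w E}.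
Proof. by case: UP => _ _; exact. Qed.

#[local] Instance Uproper w : ProperFilter (U w).
Proof. exact: ultra_proper. Qed.

Definition pt_functional (w : T) (x : X) : R := lim (k x v @[v --> U w]).
Local Notation l := pt_functional.

Lemma pt_functional_cvg w x : k x v @[v --> U w] --> l w x.
Proof. exact: (ultra_cvg_bounded (Uultra w) (kC x)). Qed.

Lemma pt_functional_le w x (K : R) : U w [set v | k x v <= K] -> l w x <= K.
Proof.
move=> UK; apply: limr_le => //.
by apply/cvg_ex; exists (l w x); exact: pt_functional_cvg.
Qed.

Lemma pt_functional_bounded w x : `|l w x| <= C * rnorm x.
Proof.
have lc : cvg (k x v @[v --> U w]).
  by apply/cvg_ex; exists (l w x); exact: pt_functional_cvg.
rewrite ler_norml; apply/andP; split.
  apply: limr_ge => //; apply: filterE => v.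
  by have := kC x v; rewrite ler_norml => /andP[].
apply: limr_le => //; apply: filterE => v.
by have := kC x v; rewrite ler_norml => /andP[].
Qed.

(** The null set where [k] fails to be linear depends on [a], [x] and [y], but
    its complement belongs to every [U w]: this is where linearity almost
    everywhere becomes linearity at every point. *)
Lemma pt_functional_linear w a x y : l w (a%:C *: x + y) = a * l w x + l w y.
Proof.
apply: cvg_lim => //.
have : (a * k x v + k y v) @[v --> U w] --> a * l w x + l w y.
  by apply: cvgD; [apply: cvgMr|]; exact: pt_functional_cvg.
apply: cvg_trans; apply: near_eq_cvg.
by apply: filterS (Uae (k_linear a x y) w) => v /= ->.
Qed.

Lemma pt_functional_ae x : {ae mu, forall w, l w x = k x w}.
Proof.
apply: filterS (density_filter_cvg Uproper Ud (mk x)) => w kw.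
exact: cvg_lim.
Qed.

Lemma pt_functional_simple_ae (s : T -> X) : simple s ->
  {ae mu, forall w, l w (s w) = k (s w) w}.
Proof.
move=> [/finite_seqP[r rE] _].
have := ae_foralln (fun n => pt_functional_ae (nth 0 r n)).
apply: filterS => w lk.
have sr : s w \in r by have : range s (s w) by []; rewrite rE.
by rewrite -(nth_index 0 sr).
Qed.

Lemma k_simple_measurable (s : T -> X) : simple s ->
  measurable_fun setT (fun w => k (s w) w).
Proof.
move=> [fs ms] _ B mB; rewrite setTI.
have -> : (fun w => k (s w) w) @^-1` B =
    \bigcup_(x in range s) (s @^-1` [set x] `&` k x @^-1` B).
  apply/seteqP; split => w; first by exists (s w).
  by move=> [x _ [/= ->]].
apply: fin_bigcup_measurable => // x _; apply: measurableI => //.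
by rewrite -[X in measurable X]setTI; exact: mk.
Qed.

Lemma pt_functional_simple_measurable (s : T -> X) : simple s ->
  ae_measurable mu (fun w => l w (s w)).
Proof.
move=> ss; exists (fun w => k (s w) w); first exact: k_simple_measurable.
exact: pt_functional_simple_ae.
Qed.

(** Induction on the list [r] of values, splitting off the part of [s] that takes
    the first one. *)
Lemma Re_functional_simple_in (r : seq X) (s : T -> X) (E : set T) : simple s ->
  measurable E -> (mu E < +oo)%E -> (forall w, ~ E w -> s w = 0) ->
  (forall w, E w -> s w \in r) -> Phi s = \int[mu]_(w in E) k (s w) w.
Proof.
elim: r s E => [|x r IH] s E ss mE Efin sE sr.
  have -> : s = 0.
    by apply/funext => w; apply: sE => /sr.
  have -> : E = set0 by apply/seteqP; split => // w /sr.
  rewrite Rintegral_set0; have := Re_functional_le phi (bochner_integrable0 mu X).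
  rewrite /int_norm; under eq_integral do rewrite rnorm0.
  by rewrite integral0 /= mulr0 normr_le0 => /eqP.
pose Ex := E `&` s @^-1` [set x].
have mEx : measurable Ex by apply: measurableI => //; exact: ss.2.
have mEr : measurable (E `\` Ex) by exact: measurableD.
have Exfin : (mu Ex < +oo)%E.
  by apply: le_lt_trans Efin; apply: le_measure; rewrite ?inE// => ? [].
have Erfin : (mu (E `\` Ex) < +oo)%E.
  by apply: le_lt_trans Efin; apply: le_measure; rewrite ?inE// => ? [].
pose s' w := s w - indic_vec Ex x w.
have ss' : simple s' by apply: (simple_op (fun y z => y - z)) => //; exact: indic_vec_simple.
have s'0 w : ~ (E `\` Ex) w -> s' w = 0.
  rewrite /s' /indic_vec => nE; case: ifPn => [/set_mem[_ ->]|]; first by rewrite subrr.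
  rewrite notin_setE subr0 => nEx; apply: sE => Ew; exact: nE.
have s's w : (E `\` Ex) w -> s' w = s w.
  by move=> [_ nEx]; rewrite /s' /indic_vec memNset// subr0.
have s'r w : (E `\` Ex) w -> s' w \in r.
  move=> Ew; rewrite s's//; case: Ew => Ew nEx.
  have := sr _ Ew; rewrite inE => /orP[/eqP sx|//].
  by exfalso; apply: nEx.
have iks F : measurable F -> F `<=` E -> mu.-integrable F (EFin \o (fun w => k (s w) w)).
  move=> mF FE; have /finite_seqP[q qE] := ss.1.
  apply: (@bounded_integrable _ _ _ _ _ (C * \sum_(y <- q) rnorm y)) => //.
  - exact: k_simple_measurable.
  - move=> w; apply: le_trans (kC _ _) _; rewrite ler_wpM2l ?dual_norm_ge0//.
    have sq : s w \in q by have : range s (s w) by []; rewrite qE.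
    rewrite (big_rem (s w))//= lerDl; apply: sumr_ge0 => y _; exact: rnorm_ge0.
  - by apply: le_lt_trans Efin; apply: le_measure; rewrite ?inE.
have bs' : bochner_integrable mu s'.
  apply: integrable_simple_bochner; split => //.
  apply: le_lt_trans Erfin; apply: le_measure; rewrite ?inE//.
    exact: (simple_preimage [set y | y <> 0] ss').
  by move=> w /= s'w; apply: contrapT => /s'0.
have -> : s = 1%:C *: indic_vec Ex x + s'.
  by apply/funext => w; rewrite !fctE /s' scale1r addrC subrK.
rewrite Re_functional_linear//; last exact: indic_vec_integrable.
rewrite mul1r kE// (IH s' (E `\` Ex))//.
have -> : (fun w => k ((1%:C *: indic_vec Ex x + s') w) w) = (fun w => k (s w) w).
  by apply/funext => w; rewrite !fctE /s' scale1r addrC subrK.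
rewrite -[in RHS](setDUK (_ : Ex `<=` E)); last by move=> ? [].
rewrite Rintegral_setU//.
- congr (_ + _); apply: eq_Rintegral => w; rewrite inE.
    by move=> [_ /= ->].
  by move=> /s's ->.
- by apply: iks; [exact: measurableU|rewrite setDUK// => ? []].
- by apply/eqP; rewrite setDE setICA setICr setI0.
Qed.

Lemma pt_functional0 w : l w 0 = 0.
Proof.
by have := pt_functional_bounded w 0; rewrite rnorm0 mulr0 normr_le0 => /eqP.
Qed.

Lemma pt_functionalB w x y : l w (x - y) = l w x - l w y.
Proof.
have := pt_functional_linear w (-1) y x; rewrite rmorphN scaleN1r addrC => ->.
by rewrite mulN1r addrC.
Qed.

Definition pt_integral (f : T -> X) : R := Rintegral mu setT (fun w => l w (f w)).

Lemma Re_functional_simple (s : T -> X) : integrable_simple mu s ->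
  Phi s = pt_integral s.
Proof.
move=> [ss sfin]; have /finite_seqP[r rE] := ss.1.
pose E := [set w | s w <> 0].
have mE : measurable E by exact: (simple_preimage [set y | y <> 0] ss).
rewrite (@Re_functional_simple_in r s E)//.
- rewrite Rintegral_mkcond; apply: ae_eq_Rintegral.
  apply: filterS (pt_functional_simple_ae ss) => w lk.
  rewrite patchE; case: (boolP (w \in E)) => [//|].
  by rewrite notin_setE => /contrapT ->; rewrite pt_functional0.
- by move=> w /contrapT.
- by move=> w _; have : range s (s w) by []; rewrite rE.
Qed.

(** Since [l w] is bounded by [C] uniformly in [w], an almost everywhere limit of
    simple functions is transformed into an almost everywhere limit. *)
Lemma pt_functional_measurable (f : T -> X) : strongly_measurable mu f ->
  ae_measurable mu (fun w => l w (f w)).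
Proof.
move=> [s [ss sf]]; apply: (@ae_measurable_lim _ _ _ _ (fun n w => l w (s n w))).
  by move=> n; exact: pt_functional_simple_measurable.
apply: filterS sf => w sf.
have Cs : C * rnorm (f w - s n w) @[n --> \oo] --> (0 : R).
  rewrite -(mulr0 C); apply: cvgMr; rewrite -[0](@rnorm0 R X); apply: cvg_rnorm.
  by rewrite -[0](subrr (f w)); apply: cvgB => //; exact: cvg_cst.
apply/cvgrPdist_lt => e e0; move/cvgrPdist_lt : Cs => /(_ e e0); apply: filterS => n.
rewrite sub0r normrN => /(le_lt_trans _); apply.
by rewrite -pt_functionalB; apply: le_trans (pt_functional_bounded _ _) (ler_norm _).
Qed.

(** The measurable representative [h] makes the linearity of the integral
    applicable; the constant [K] is [C] except for the bound of the norm of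
    [phi] by the essential supremum of the norms of [g]. *)
Lemma pt_integral_rep (f : T -> X) (K : R) : 0 <= K -> bochner_integrable mu f ->
  {ae mu, forall w, `|l w (f w)| <= K * rnorm (f w)} ->
  exists h : T -> R, [/\ mu.-integrable setT (EFin \o h),
    {ae mu, forall w, l w (f w) = h w} & `|pt_integral f| <= K * fine (int_norm mu f)].
Proof.
move=> K0 bf lK; have [h mh lh] := pt_functional_measurable bf.1.
have fin := int_norm_fin bf.
have hle : (\int[mu]_w `|(EFin \o h) w| <= K%:E * int_norm mu f)%E.
  have -> : (K%:E * int_norm mu f = int_norm mu (K%:C *: f)%R)%E.
    by rewrite (int_normZ _ bf.1) normc_def /= expr0n/= addr0 sqrtr_sqr ger0_norm.
  apply: ae_ge0_integral_le => [w|w|]; [by []|by rewrite lee_fin rnorm_ge0|].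
  apply: filterS2 lK lh => w lK lh /=.
  rewrite lee_fin -lh; apply: le_trans lK _.
  by rewrite (rnorm_real K (f w)) ger0_norm.
have inth : mu.-integrable setT (EFin \o h).
  apply/integrableP; split; first exact/measurable_EFinP.
  by apply: le_lt_trans hle _; rewrite -[int_norm _ _]fineK// -EFinM ltry.
exists h; split => //.
rewrite /pt_integral (ae_eq_Rintegral lh).
apply: le_trans (le_normr_Rintegral measurableT inth) _.
rewrite /Rintegral -[X in _ <= X * _]/(fine K%:E) -fineM//; apply: fine_le => //.
- rewrite ge0_fin_numE; last exact: integral_ge0.
  by apply: le_lt_trans hle _; rewrite -[int_norm _ _]fineK// -EFinM ltry.
- by rewrite fin_numM.
Qed.

Lemma pt_integral_le (f : T -> X) : bochner_integrable mu f ->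
  `|pt_integral f| <= C * fine (int_norm mu f).
Proof.
move=> bf; have [|] := @pt_integral_rep f C (dual_norm_ge0 phi) bf.
  by apply: nearW => w; exact: pt_functional_bounded.
by move=> ? [].
Qed.

Lemma pt_integralB (f g : T -> X) : bochner_integrable mu f -> bochner_integrable mu g ->
  pt_integral (f - g) = pt_integral f - pt_integral g.
Proof.
move=> bf bg.
have lC (h : T -> X) : {ae mu, forall w, `|l w (h w)| <= C * rnorm (h w)}.
  by apply: nearW => w; exact: pt_functional_bounded.
have [f' [intf lf _]] := pt_integral_rep (dual_norm_ge0 phi) bf (lC f).
have [g' [intg lg _]] := pt_integral_rep (dual_norm_ge0 phi) bg (lC g).
rewrite /pt_integral (ae_eq_Rintegral lf) (ae_eq_Rintegral lg) -RintegralB//.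
apply: ae_eq_Rintegral; apply: filterS2 lf lg => w <- <-.
by rewrite -pt_functionalB.
Qed.

(** Both sides are bounded by [C] times the norm and agree on simple functions,
    which are dense. *)
Lemma Re_functional_pt_integral (f : T -> X) : bochner_integrable mu f ->
  Phi f = pt_integral f.
Proof.
move=> bf; have [mf [s [ss sf]]] := bf.
have bs n : bochner_integrable mu (s n) by exact: integrable_simple_bochner.
have bfs n : bochner_integrable mu (f - s n).
  have -> : f - s n = (-1) *: s n + f by rewrite scaleN1r addrC.
  exact: bochner_integrable_lin.
have PhiB n : Phi (f - s n) = Phi f - Phi (s n).
  have -> : f - s n = (-1)%:C *: s n + f by rewrite rmorphN scaleN1r addrC.
  by rewrite Re_functional_linear// mulN1r addrC.
have dist n : `|Phi f - pt_integral f| <= (C + C) * fine (int_norm mu (f - s n)).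
  have -> : Phi f - pt_integral f = Phi (f - s n) - pt_integral (f - s n).
    by rewrite PhiB pt_integralB// (Re_functional_simple (ss n)); ring.
  rewrite mulrDl; apply: le_trans (ler_normB _ _) _; apply: lerD.
    exact: Re_functional_le.
  exact: pt_integral_le.
have cv : (C + C) * fine (int_norm mu (f - s n)) @[n --> \oo] --> (0 : R).
  by rewrite -(mulr0 (C + C)); apply: cvgMr; have /fine_cvgP[] := sf.
have : `|Phi f - pt_integral f| <= 0.
  rewrite -(cvg_lim (@Rhausdorff R) cv); apply: limr_ge.
    by apply/cvg_ex; exists 0.
  by apply: nearW => n; exact: dist.
by rewrite normr_le0 subr_eq0 => /eqP.
Qed.

Variable g : T -> dual X.
Hypothesis gE : forall w x, g w x = (l w x +i* - l w ('i%C *: x))%C.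

Lemma Re_g w x : complex.Re (g w x) = l w x.
Proof. by rewrite gE. Qed.

(** Used to deduce every statement about imaginary parts from the one about real
    parts, applied to [- i f]. *)
Lemma Im_g w x : complex.Im (g w x) = l w ((- 'i%C) *: x).
Proof.
rewrite gE /= -[- 'i%C]mulN1r -scalerA scaleN1r.
by rewrite -[- ('i%C *: x)]sub0r pt_functionalB pt_functional0 sub0r.
Qed.

Lemma dual_norm_g_le w (K : R) : (forall x, rnorm x <= 1 -> l w x <= K) ->
  dual_norm (g w) <= K.
Proof. by move=> lK; apply: dual_norm_le => x /lK; rewrite Re_g. Qed.

Lemma le_dual_norm_g w x : l w x <= dual_norm (g w) * rnorm x.
Proof.
by rewrite -Re_g; apply: le_trans (ler_norm _) (le_trans (Re_le_rnorm _) (le_dual_norm _ _)).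
Qed.

Lemma dual_norm_g_bounded w : dual_norm (g w) <= C.
Proof.
apply: dual_norm_g_le => x x1; apply: le_trans (ler_norm _) _.
apply: le_trans (pt_functional_bounded _ _) _.
by rewrite ler_piMr// dual_norm_ge0.
Qed.

Lemma pair_mu_measurable (f : T -> X) : strongly_measurable mu f ->
  mu_measurable mu (fun w => g w (f w)).
Proof.
move=> mf; apply: mu_measurable_complex.
  under eq_fun do rewrite Re_g; exact: pt_functional_measurable.
under eq_fun do rewrite Im_g; apply: (@pt_functional_measurable (fun w => (- 'i%C) *: f w)).
have s0 : strongly_measurable mu (0 : T -> X) := (bochner_integrable0 mu X).1.
by have := strongly_measurable_lin (- 'i%C) mf s0; rewrite addr0.
Qed.

Lemma g_weak_star : weak_star_measurable mu g.
Proof.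
move=> x; apply: (@pair_mu_measurable (fun=> x)); apply: strongly_measurable_simple.
split; first by apply: (@sub_finite_set _ _ [set x]) => // _ [w _ <-].
by move=> y; rewrite preimage_cst; case: ifP.
Qed.

(** The norm of [g w] is almost everywhere the supremum of [k x w] over a
    sequence of vectors [x].  One inequality holds because [k x w] is almost
    everywhere the value [l w x].  For the other, fix [w] and a rational [q]
    above the supremum at [w]: for almost every [w] the set [E q] where the
    supremum is at most [q] belongs to [U w], and for each [x] in the
    unit ball it is contained, up to a null set, in the set where [k x <= q];
    thus [l w x <= q]. *)
Lemma dual_norm_g_measurable : ae_measurable mu (fun w => dual_norm (g w)).
Proof.
pose I0 := {x : X | rnorm x <= 1}.
have i01 : rnorm (0 : X) <= 1 by rewrite rnorm0.
have [s sP] := ess_sup_countable mu_sf (exist _ 0 i01 : I0) (fun i => mk (sval i)).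
have ks1 n w : k (sval (s n)) w <= C.
  apply: le_trans (ler_norm _) (le_trans (kC _ _) _).
  by rewrite ler_piMr ?dual_norm_ge0//; exact: (svalP (s n)).
have ub w : has_ubound (range (fun n => k (sval (s n)) w)).
  by exists C => _ [n _ <-].
exists (fun w => sups (fun n => k (sval (s n)) w) 0).
  by apply: (measurable_fun_sups (h := fun n => k (sval (s n)))) => [w _|n].
pose E (q : rat) := [set w | forall n, k (sval (s n)) w <= ratr q].
have mE q : measurable (E q).
  rewrite (_ : E q = \bigcap_n (setT `&` k (sval (s n)) @^-1` `]-oo, ratr q]%classic)).
    by apply: bigcapT_measurable => n; exact: mk.
  apply/seteqP; split => w /=; first by move=> Ew n _; rewrite setTI /= in_itv/=.
  by move=> Ew n; have := Ew n I; rewrite setTI /= in_itv.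
have UE : {ae mu, forall w n (q : rat), unpickle n = Some q -> E q w -> U w (E q)}.
  apply/ae_foralln => n; case: (unpickle n) => [q|]; last exact: nearW.
  by apply: filterS (Ud (mE q)) => w Uw _ [<-].
have lk := ae_foralln (fun n => pt_functional_ae (sval (s n))).
apply: filterS2 UE lk => w UE lk.
have sup_le n : k (sval (s n)) w <= sups (fun n => k (sval (s n)) w) 0.
  by apply: ub_le_sup; [exists C => _ [m _ <-]|exists n].
apply/eqP; rewrite eq_le; apply/andP; split; last first.
  apply: ge_sup; first by exists (k (sval (s 0%N)) w), 0%N.
  move=> _ [n _ <-]; rewrite -lk; apply: le_trans (le_dual_norm_g _ _) _.
  by rewrite ler_piMr ?dual_norm_ge0//; exact: (svalP (s n)).
rewrite leNgt; apply/negP => /rat_in_itvoo[q]; rewrite in_itv/= => /andP[supq].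
apply/negP; rewrite -leNgt; apply: dual_norm_g_le => x x1.
apply: pt_functional_le.
have /(UE (pickle q) q (pickleK q)) UEq : E q w.
  by move=> n; apply: le_trans (sup_le n) (ltW supq).
have := Uae (sP (exist _ x x1 : I0) q) w; apply: filterS2 UEq => v Ev qv /=.
rewrite leNgt; apply/negP => /qv[n]; apply/negP; rewrite -leNgt; exact: Ev.
Qed.

Lemma g_represents (f : bochner mu X) :
  cintegrable mu (fun w => g w (f w)) /\
  phi (L1class f) = cintegral mu (fun w => g w (f w)).
Proof.
have bf := bochnerP f; have fin := int_norm_fin bf; split.
  split; first exact: pair_mu_measurable bf.1.
  apply: (@le_lt_trans _ _ (int_norm mu (C%:C *: (f : T -> X))%R)).
    apply: ae_ge0_integral_le => [w|w|]; [by rewrite lee_fin rnorm_ge0..|].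
    apply: nearW => w; rewrite lee_fin (rnorm_real C (f w)) ger0_norm ?dual_norm_ge0//.
    apply: le_trans (le_dual_norm _ _) _; rewrite ler_wpM2r ?rnorm_ge0//.
    exact: dual_norm_g_bounded.
  rewrite (int_normZ _ bf.1) -[int_norm _ _]fineK// -EFinM ltry//.
have phiRe (F : bochner mu X) : complex.Re (phi (L1class F)) = pt_integral F.
  by rewrite -Re_functionalE; exact: Re_functional_pt_integral (bochnerP F).
apply/eqP; rewrite eq_complex /cintegral /=; apply/andP; split; apply/eqP.
  by rewrite phiRe; congr Rintegral; apply/funext => w; rewrite Re_g.
have -> : complex.Im (phi (L1class f)) = complex.Re (phi (L1class ((- 'i%C) *: f))).
  by rewrite L1classZ linearZ /=; case: (phi _) => a b /=; ring.
by rewrite phiRe; congr Rintegral; apply/funext => w; rewrite Im_g.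
Qed.

(** The norm of [g w] is at most [C] at every point; conversely, the norm of
    [phi] is bounded by any almost everywhere bound of the norms of [g] because
    of the integral formula. *)
Lemma g_norm : (dual_norm phi)%:E = 'N[mu]_+oo[EFin \o (fun w => dual_norm (g w))]%E.
Proof.
set N := (X in _ = X).
have N0 : (0 <= N)%E by exact: Lnorm_ge0.
have NC : (N <= C%:E)%E.
  rewrite /N unlock; case: ifPn => _; last by rewrite lee_fin dual_norm_ge0.
  apply/ess_supP; apply: nearW => w.
  by rewrite /= lee_fin ger0_norm ?dual_norm_ge0//; exact: dual_norm_g_bounded.
have Nfin : N \is a fin_num by rewrite ge0_fin_numE// (le_lt_trans NC)// ltry.
apply/eqP; rewrite eq_le NC andbT -[N]fineK// lee_fin.
have gN : {ae mu, forall w, dual_norm (g w) <= fine N}.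
  have [mu0|mu0] := eqVneq (mu setT) 0%E; first exact: measure0_ae.
  have : (ess_sup mu (abse \o (EFin \o (fun w => dual_norm (g w)))) <= N)%E.
    by rewrite /N unlock lt_neqAle eq_sym mu0 measure_ge0.
  move=> /ess_supP; apply: filterS => w.
  rewrite /= -[N]fineK// lee_fin; exact/le_trans/ler_norm.
apply: dual_norm_le => u u1.
have bu := bochnerP (L1repr u).
rewrite -(L1reprK u) -Re_functionalE Re_functional_pt_integral//.
apply: le_trans (ler_norm _) _.
have fN0 : 0 <= fine N by exact: fine_ge0.
have [|_ [_ _]] := pt_integral_rep fN0 bu.
  apply: filterS gN => w gN; rewrite -Re_g; apply: le_trans (Re_le_rnorm _) _.
  by apply: le_trans (le_dual_norm _ _) _; rewrite ler_wpM2r// rnorm_ge0.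
by move=> /le_trans; apply; rewrite ler_piMr.
Qed.

End representation.

Section main.
Context {R : realType} {X : normedModType R[i]}.
Context {d : measure_display} {T : measurableType d}.
Variable mu : {measure set T -> \bar R}.
Variable phi : dual (L1 mu X).
Local Open Scope complex_scope.

Definition w_star_density (g : T -> dual X) :=
  [/\ weak_star_measurable mu g,
        mem_Linfty mu (fun w => dual_norm (g w)),
        (forall f : bochner mu X,
           cintegrable mu (fun w => g w (f w)) /\
           phi (L1class f) = cintegral mu (fun w => g w (f w))) &
        (dual_norm phi)%:E = 'N[mu]_+oo[EFin \o (fun w => dual_norm (g w))]%E].

(** No proper filter contains the conull sets of a null space, which has to be
    treated apart. *)
Lemma w_star_density_null : mu setT = 0%E -> exists g, w_star_density g.
Proof.
move=> mu0; have ae_all (S : set T) : {ae mu, forall w, S w} by exact: measure0_ae.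
have [|x|z _] := @dual_of_real R X (fun=> 0) 0.
- by move=> *; rewrite mulr0 addr0.
- by rewrite normr0 mul0r.
have meas (Y : topologicalType) (h : T -> Y) : mu_measurable mu h.
  by move=> O _; apply: (@completed_ae _ _ _ mu _ set0).
have int0 (f : T -> \bar R) : (\int[mu]_w f w = 0)%E.
  by rewrite (ae_integral_eq (g := fun=> 0%E)) ?integral0.
have norm0 f : 'N[mu]_+oo[f]%E = 0%E by rewrite unlock mu0 ltxx.
have phi0 u : phi u = 0.
  rewrite (_ : u = 0) ?linear0// -(L1reprK u) -[RHS](raddf0 (@L1class _ _ _ mu X)).
  exact/L1class_eq.
exists (fun=> z); split => //.
- by split => //; rewrite norm0 ltry.
- move=> f; split; first by split => //; rewrite int0 ltry.
  by rewrite phi0 /cintegral /Rintegral !int0.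
- rewrite norm0; congr (_%:E); apply/eqP; rewrite eq_le dual_norm_ge0 andbT.
  by apply: dual_norm_le => u _; rewrite phi0.
Qed.

Lemma w_star_density_exists : sigma_finite setT mu -> exists g, w_star_density g.
Proof.
move=> mu_sf; have [mu0|mu0] := eqVneq (mu setT) 0%E; first exact: w_star_density_null.
have [U UP] := sigma_finite_density_ultrafilters mu_sf mu0.
have [k kP] := scalar_density_exists mu_sf phi.
have /choice[g gE] : forall w, exists g : dual X, forall x,
    g x = (pt_functional k U w x +i* - pt_functional k U w ('i%C *: x))%C.
  move=> w; apply: (@dual_of_real _ _ _ (dual_norm phi)).
  - by move=> a x y; exact: (pt_functional_linear mu_sf kP UP).
  - by move=> x; exact: (pt_functional_bounded kP UP).
exists g; split.
- exact: (g_weak_star mu_sf kP UP gE).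
- split; last by rewrite -(g_norm mu_sf kP UP gE) ltry.
  apply: ae_measurable_mu_measurable.
  exact: (dual_norm_g_measurable mu_sf kP UP gE).
- exact: (g_represents mu_sf kP UP gE).
- exact: (g_norm mu_sf kP UP gE).
Qed.

End main.

Unset Implicit Arguments.

Theorem corollary2p3 (R : realType) (X : completeNormedModType R[i])
    (d : measure_display) (T : measurableType d)
    (mu : {measure set T -> \bar R}) (mu_sf : sigma_finite setT mu)
    (phi : dual (L1 mu X)) :
  exists g : T -> dual X,
    [/\ weak_star_measurable mu g,
        mem_Linfty mu (fun w => dual_norm (g w)),
        (forall f : bochner mu X,
           cintegrable mu (fun w => g w (f w)) /\
           phi (L1class f) = cintegral mu (fun w => g w (f w))) &
        (dual_norm phi)%:E = 'N[mu]_+oo[EFin \o (fun w => dual_norm (g w))]%E].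
Proof.
exact: w_star_density_exists.
Qed.
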